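(* Let $B=B(b_1,\dots,b_n)$ be a Ferrers board with $0\le b_1\le b_2\le\cdots\le b_n\le n$. Then \[ \prod_{i=1}^n [z+b_i-i+1]_{aq^{2(i-1-b_i)},\,bq^{i-1-b_i};q,p} =\sum_{k=0}^{n}r_{n-k}(a,b;q,p;B)\prod_{j=1}^k[z-j+1]_{aq^{2(j-1)},\,bq^{j-1};q,p}. \]
   Context: $|p|<1$, $q$, $a$, $b$, $z$ generic complex parameters (with $q^{z+m}:=q^zq^m$). $\theta(x;p)=\prod_{j\ge0}(1-p^jx)(1-p^{j+1}/x)$, $\theta(x_1,\dots,x_m;p)=\prod_i\theta(x_i;p)$. For parameters $A,B$: $[z]_{A,B;q,p}=\frac{\theta(q^z,Aq^z,Bq^2,A/B;p)}{\theta(q,Aq,Bq^{z+1},Aq^{z-1}/B;p)}$, and $w_{a,b;q,p}(k)=\frac{\theta(aq^{2k+1},bq^k,aq^{k-2}/b;p)}{\theta(aq^{2k-1},bq^{k+2},aq^k/b;p)}\,q$. The board $B(b_1,\dots,b_n)$ is the set of cells $(i,j)$ with $1\le i\le n$, $1\le j\le b_i$ (column $i$, row $j$). $\mathcal{N}_k(B)$ is the set of placements of $k$ rooks in $B$ with no two in the same row or column; a rook cancels the cells to its right in its row and below it in its column; $U_B(P)$ is the set of cells of $B\setminus P$ not cancelled by $P$; $r_{P,(i,j)}$ is the number of rooks of $P$ at cells $(i',j')$ with $i'<i$, $j'>j$. The elliptic rook numbers are $r_k(a,b;q,p;B)=\sum_{P\in\mathcal{N}_k(B)}\prod_{(i,j)\in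 U_B(P)}w_{a,b;q,p}(i-j-r_{P,(i,j)})$. *)

(* Defs.v *)
From HB Require Import structures.
From mathcomp Require Import all_boot all_order all_algebra complex.
From mathcomp Require Import all_classical all_reals all_analysis.
Import Order.TTheory GRing.Theory Num.Theory numFieldNormedType.Exports.

Set Implicit Arguments.
Unset Strict Implicit.
Unset Printing Implicit Defensive.

Local Open Scope ring_scope.
Local Open Scope complex_scope.

Definition expC (R : realType) (z : R[i]) : R[i] :=
  (expR (complex.Re z))%:C * (cos (complex.Im z) +i* sin (complex.Im z)).

(* q^z for the value l of log q, where q = expC l; hence q^(z+m) = q^z q^m
   for every integer m, whichever logarithm l of q is chosen. *)
Definition qpow (R : realType) (l z : R[i]) : R[i] := expC (l * z).

(* The annotation R[i]^o equips R[i] with the topology of its modulus. *)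
Definition theta (R : realType) (p x : R[i]) : R[i] :=
  limn ((fun N => \prod_(j < N) ((1 - p ^+ j * x) * (1 - p ^+ j.+1 / x)))
        : nat -> R[i]^o).

Definition thetas (R : realType) (p : R[i]) (s : seq R[i]) : R[i] :=
  \prod_(x <- s) theta p x.

(* Numerator and denominator of [z]_{A,B;q,p}, where q = expC l. *)
Definition ellnum_num (R : realType) (l p A B z : R[i]) : R[i] :=
  thetas p [:: qpow l z; A * qpow l z; B * expC l ^+ 2; A / B].

Definition ellnum_den (R : realType) (l p A B z : R[i]) : R[i] :=
  thetas p [:: expC l; A * expC l; B * qpow l (z + 1); A * qpow l (z - 1) / B].

Definition ellnum (R : realType) (l p A B z : R[i]) : R[i] :=
  ellnum_num l p A B z / ellnum_den l p A B z.

Definition weight_num (R : realType) (q p a b : R[i]) (k : int) : R[i] :=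
  thetas p [:: a * q ^ (2 * k + 1); b * q ^ k; a * q ^ (k - 2) / b].

Definition weight_den (R : realType) (q p a b : R[i]) (k : int) : R[i] :=
  thetas p [:: a * q ^ (2 * k - 1); b * q ^ (k + 2); a * q ^ k / b].

Definition weight (R : realType) (q p a b : R[i]) (k : int) : R[i] :=
  weight_num q p a b k / weight_den q p a b k * q.

(* A cell c has column c.1 and row c.2, both counted from 0, rows from the
   bottom up.  Column i of the Ferrers board consists of its h i lowest cells;
   the grid is assumed high enough, i.e. h i <= m. *)
Definition ferrers (n m : nat) (h : 'I_n -> nat) : {set 'I_n * 'I_m} :=
  [set c : 'I_n * 'I_m | (c.2 < h c.1)%N].

Definition placements (n m : nat) (B : {set 'I_n * 'I_m}) (k : nat) :
    {set {set 'I_n * 'I_m}} :=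
  [set P : {set 'I_n * 'I_m} | [&& P \subset B, #|P| == k &
    [forall c in P, forall d in P,
      (c != d) ==> (c.1 != d.1) && (c.2 != d.2)]]].

Definition cancels (n m : nat) (rk c : 'I_n * 'I_m) : bool :=
  (rk.2 == c.2) && (rk.1 < c.1)%N || (rk.1 == c.1) && (c.2 < rk.2)%N.

Definition uncancelled (n m : nat) (B P : {set 'I_n * 'I_m}) :
    {set 'I_n * 'I_m} :=
  [set c in B :\: P | ~~ [exists rk in P, cancels rk c]].

Definition nw_rooks (n m : nat) (P : {set 'I_n * 'I_m}) (c : 'I_n * 'I_m) :
    nat :=
  #|[set rk in P | (rk.1 < c.1)%N && (c.2 < rk.2)%N]|.

(* i - j - r_{P,(i,j)}; counting i and j from 0 does not affect it. *)
Definition cell_index (n m : nat) (P : {set 'I_n * 'I_m}) (c : 'I_n * 'I_m) :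
    int :=
  (c.1 : nat)%:Z - (c.2 : nat)%:Z - (nw_rooks P c)%:Z.

Definition rook_number (R : realType) (q p a b : R[i]) (n m : nat)
    (B : {set 'I_n * 'I_m}) (k : nat) : R[i] :=
  \sum_(P in placements B k)
    \prod_(c in uncancelled B P) weight q p a b (cell_index P c).

(* Main.v *)
(* Put q = exp l, E(N) = [z-N]_{a q^(2N), b q^N} and let w be the weight.  The
   case [E(N-1) = 1 + w(N) E(N)] of Weierstrass' addition formula for theta,
   iterated upwards over the cells of column i that are not cancelled by a
   placement P of rooks in the columns to its left, expresses E(i - h_i) as the
   total weight of the ways to place a rook in column i, plus the weight of
   placing none times E(i - |P|).  The theorem follows by adding the columns
   from left to right.  The only factor of the denominator of E(N) that depends
   on N is theta(a q^(2N+1)), which divides the denominator of w(N+1); hence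
   the intermediate E(N) have nonzero denominators.

   For the addition formula, let P_N be the truncated product of theta.  Up to
   terms of size p^N, the coefficients of x^(2N) P_N(xy) P_N(x/y) near the
   middle degree satisfy a two-step recurrence that does not involve y, and the
   outer ones are negligible.  So theta(xy) theta(x/y) is a limit of functions
   of rank two, and its 3x3 minors vanish; as it is alternating after division
   by x, its 4x4 Pfaffians vanish as well, which is the addition formula. *)

Require Import Defs.
From HB Require Import structures.
From mathcomp Require Import all_boot all_order all_algebra complex.
From mathcomp Require Import all_classical all_reals all_analysis.
From mathcomp Require Import ring zify.
Import Order.TTheory GRing.Theory Num.Theory numFieldNormedType.Exports.
Import Normc.
Local Open Scope ring_scope.
Local Open Scope complex_scope.

(** * Convergence in the complex numbers *)

Lemma normE_normc (R : realType) (z : R[i]) : `|z| = (normc z)%:C.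
Proof. by []. Qed.

Lemma Re_le_normc (R : realType) (z : R[i]) : `|complex.Re z| <= normc z.
Proof.
case: z => a b /=; rewrite -sqrtr_sqr ler_wsqrtr //.
by rewrite lerDl sqr_ge0.
Qed.

Lemma Im_le_normc (R : realType) (z : R[i]) : `|complex.Im z| <= normc z.
Proof.
case: z => a b /=; rewrite -sqrtr_sqr ler_wsqrtr //.
by rewrite lerDr sqr_ge0.
Qed.

Lemma normc_le_ReIm (R : realType) (z : R[i]) :
  normc z <= `|complex.Re z| + `|complex.Im z|.
Proof.
case: z => a b /=; rewrite -[leRHS]ger0_norm ?addr_ge0 // -sqrtr_sqr.
rewrite ler_wsqrtr // sqrrD !real_normK ?num_real //.
by rewrite addrAC lerDl mulrn_wge0 // mulr_ge0.
Qed.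

Lemma cvg_complex (R : realType) (u : nat -> R[i]) (a b : R) :
  (complex.Re (u n) @[n --> \oo] --> a)%classic ->
  (complex.Im (u n) @[n --> \oo] --> b)%classic ->
  ((u : nat -> R[i]^o) n @[n --> \oo] --> (a +i* b : R[i]^o))%classic.
Proof.
move=> ua ub; apply/cvgrPdist_lt => e; rewrite ltcE /= => /andP[/eqP e0 e1].
have e2 : 0 < complex.Re e / 2 by rewrite divr_gt0.
move/cvgrPdist_lt: ua => /(_ _ e2) ua; move/cvgrPdist_lt: ub => /(_ _ e2) ub.
near=> n.
have h1 : `|a - complex.Re (u n)| < complex.Re e / 2 by near: n.
have h2 : `|b - complex.Im (u n)| < complex.Re e / 2 by near: n.
rewrite [ltLHS](_ : _ = (normc (a +i* b - u n))%:C) //.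
rewrite ltcE /= e0 eqxx /=.
apply: (le_lt_trans (normc_le_ReIm _ _)).
rewrite [ltRHS](splitr (complex.Re e)) ltrD //.
  by case: (u n) h1.
by case: (u n) h2.
Unshelve. all: by end_near. Qed.

(** The sequence is its first term plus a telescoping series, and that series converges absolutely
    by comparison with a geometric one. *)
Lemma cvg_geometric_increments_real (R : realType) (u : nat -> R) (c r : R) :
  0 <= r -> r < 1 -> (forall n, `|u n.+1 - u n| <= c * r ^+ n) ->
  cvgn u.
Proof.
move=> r0 r1 hu.
have : cvgn (series (telescope u)).
  apply: normed_cvg; apply: series_le_cvg.
  - by move=> n /=; exact: normr_ge0.
  - by move=> n; apply: (le_trans (normr_ge0 _) (hu n)).
  - by move=> n /=; exact: hu.
  - by apply: is_cvg_geometric_series; rewrite ger0_norm.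
move=> cs.
suff -> : u = (fun n => u 0 + series (telescope u) n).
  by apply: is_cvgD => //; exact: is_cvg_cst.
by apply/funext => n; rewrite -eq_sum_telescope.
Qed.

Lemma cvg_geometric_increments (R : realType) (u : nat -> R[i]) (c r : R) :
  0 <= r -> r < 1 -> (forall n, normc (u n.+1 - u n) <= c * r ^+ n) ->
  cvgn (u : nat -> R[i]^o).
Proof.
move=> r0 r1 hu.
have ReB (x y : R[i]) : complex.Re (x - y) = complex.Re x - complex.Re y.
  by case: x; case: y.
have ImB (x y : R[i]) : complex.Im (x - y) = complex.Im x - complex.Im y.
  by case: x; case: y.
have cr : cvgn (fun n => complex.Re (u n)).
  apply: (@cvg_geometric_increments_real _ _ c r) => // n.
  by rewrite -ReB; exact: le_trans (Re_le_normc _ _) (hu n).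
have ci : cvgn (fun n => complex.Im (u n)).
  apply: (@cvg_geometric_increments_real _ _ c r) => // n.
  by rewrite -ImB; exact: le_trans (Im_le_normc _ _) (hu n).
by apply/cvg_ex; eexists; apply: (cvg_complex _ _ _ _ cr ci).
Qed.

(** Each factor satisfies 1 + s <= exp s, and the exponents add up to at most t / (1 - r), whatever
    n is. *)
Lemma prod_geometric_bounded (R : realType) (r t : R) :
  0 <= r -> r < 1 -> 0 <= t ->
  exists M : R, forall n, \prod_(j < n) (1 + r ^+ j * t) <= M.
Proof.
move=> r0 r1 t0; exists (expR (t / (1 - r))) => n.
apply: (@le_trans _ _ (\prod_(j < n) expR (r ^+ j * t))).
  apply: ler_prod => j _.
  by rewrite addr_ge0 ?mulr_ge0 ?exprn_ge0 //= expR_ge1Dx.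
rewrite -expR_sum ler_expR -mulr_suml mulrC ler_wpM2l //.
have d : 0 < 1 - r by rewrite subr_gt0.
rewrite -[leLHS](mulfK (lt0r_neq0 d)) -[leRHS]mul1r ler_pM2r ?invr_gt0 //.
have -> : (\sum_(i < n) r ^+ i) * (1 - r) = 1 - r ^+ n.
  by rewrite mulrC -[1 - r]opprB mulNr -subrX1 opprB.
by rewrite gerBl exprn_ge0.
Qed.

(** A positive element of [R[i]] has imaginary part 0, so the radii in the definition of the limit
    may be taken in [R]. *)
Lemma cvg_normcP (R : realType) (u : nat -> R[i]) (l : R[i]) :
  ((u : nat -> R[i]^o) n @[n --> \oo] --> (l : R[i]^o))%classic <->
  forall e : R, 0 < e -> (\forall n \near \oo, normc (l - u n) < e)%classic.
Proof.
split=> [/cvgrPdist_lt ul e e0|ul].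
  have e0' : 0 < e%:C by rewrite ltcR.
  apply: filterS (ul _ e0') => n.
  by rewrite [X in X < _ -> _](_ : _ = (normc (l - u n))%:C) // ltcR.
apply/cvgrPdist_lt => e; rewrite ltcE /= => /andP[/eqP e0 e1].
apply: filterS (ul _ e1) => n h.
by rewrite [ltLHS](_ : _ = (normc (l - u n))%:C) // ltcE /= e0 eqxx.
Qed.

Lemma normc_zero (R : realType) : normc (0 : R[i]) = 0.
Proof. exact: normc0. Qed.

Lemma normc_opp (R : realType) (z : R[i]) : normc (- z) = normc z.
Proof. exact: normcN. Qed.

Lemma normcX (R : realType) (z : R[i]) n : normc (z ^+ n) = normc z ^+ n.
Proof. by elim: n => [|n IH]; rewrite ?expr0 ?normc1 // !exprS normcM IH. Qed.

Lemma normc_ge0 (R : realType) (z : R[i]) : 0 <= normc z.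
Proof. exact: le_trans (normr_ge0 _) (Re_le_normc _ _). Qed.

Lemma normc_lt1 (R : realType) (p : R[i]) : `|p| < 1 -> normc p < 1.
Proof. by rewrite normE_normc -[1]/(1%:C) ltcR. Qed.

Lemma normc_prod (R : realType) (I : Type) (s : seq I) (F : I -> R[i]) :
  normc (\prod_(j <- s) F j) = \prod_(j <- s) normc (F j).
Proof.
by elim: s => [|x s IH]; rewrite ?big_nil ?normc1 // !big_cons normcM IH.
Qed.

Lemma normc_sum (R : realType) (I : Type) (s : seq I) (F : I -> R[i]) :
  normc (\sum_(j <- s) F j) <= \sum_(j <- s) normc (F j).
Proof.
elim: s => [|x s IH]; rewrite ?big_nil ?normc_zero // !big_cons.
by apply: le_trans (le_normcD _ _) _; rewrite lerD2l.
Qed.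

Lemma cvg0D (R : realType) (u v : nat -> R[i]) :
  ((u : nat -> R[i]^o) n @[n --> \oo] --> (0 : R[i]^o))%classic ->
  ((v : nat -> R[i]^o) n @[n --> \oo] --> (0 : R[i]^o))%classic ->
  (((fun n => u n + v n) : nat -> R[i]^o) n @[n --> \oo] --> (0 : R[i]^o))%classic.
Proof. by move=> u0 v0; rewrite -[X in (_ --> X)%classic]addr0; exact: cvgD. Qed.

Lemma cvg_bounded_mul0 (R : realType) (u v : nat -> R[i]) (M : R) :
  (forall n, normc (v n) <= M) ->
  ((u : nat -> R[i]^o) n @[n --> \oo] --> (0 : R[i]^o))%classic ->
  (((fun n => u n * v n) : nat -> R[i]^o) n @[n --> \oo] --> (0 : R[i]^o))%classic.
Proof.
move=> vM /cvg_normcP u0; apply/cvg_normcP => e e0.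
have M1 : 0 < M + 1.
  by rewrite ltr_wpDl // (le_trans (normc_ge0 _ _) (vM 0)).
apply: filterS (u0 _ (divr_gt0 e0 M1)) => n.
rewrite !sub0r !normcN normcM ltr_pdivlMr // => h.
apply: le_lt_trans h; rewrite ler_wpM2l ?normc_ge0 //.
by rewrite (le_trans (vM n)) // lerDl.
Qed.

Lemma cvg_expC0 (R : realType) (p : R[i]) : `|p| < 1 ->
  (((fun n => p ^+ n) : nat -> R[i]^o) n @[n --> \oo] --> (0 : R[i]^o))%classic.
Proof.
move=> /normc_lt1 p1; apply/cvg_normcP => e e0.
have : ((fun n => normc p ^+ n) n @[n --> \oo] --> (0 : R))%classic.
  by apply: cvg_expr; rewrite ger0_norm ?normc_ge0.
move/cvgrPdist_lt => /(_ _ e0); apply: filterS => n.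
by rewrite !sub0r normcN normcX normrN ger0_norm // exprn_ge0 ?normc_ge0.
Qed.

(** * Truncated theta products and their convergence *)

Definition theta_part {R : realType} (p x : R[i]) (N : nat) : R[i] :=
  \prod_(j < N) ((1 - p ^+ j * x) * (1 - p ^+ j.+1 / x)).

Lemma normc_1sub (R : realType) (p x : R[i]) j :
  normc (1 - p ^+ j * x) <= 1 + normc p ^+ j * normc x.
Proof.
by apply: le_trans (le_normcD _ _) _; rewrite normc1 normcN normcM normcX.
Qed.

(** Since [theta] is defined by [limn], nothing can be said about it before convergence is known.
    The partial products are bounded, and consecutive ones differ by p^N times a bounded
    quantity. *)
Lemma theta_cvg (R : realType) (p x : R[i]) : `|p| < 1 -> x != 0 ->
  (((theta_part p x) : nat -> R[i]^o) N @[N --> \oo] --> (theta p x : R[i]^o))%classic.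
Proof.
move=> /normc_lt1 p1 x0; have p0 := normc_ge0 _ p.
have [M1 hM1] := prod_geometric_bounded _ _ _ p0 p1 (normc_ge0 _ x).
have [M2 hM2] := prod_geometric_bounded _ _ _ p0 p1 (normc_ge0 _ (p / x)).
have hb N : normc (theta_part p x N) <= M1 * M2.
  rewrite normc_prod; under eq_bigr do rewrite normcM.
  rewrite big_split /= ler_pM ?prodr_ge0 // => [i _|i _| |]; rewrite ?normc_ge0 //.
    apply: le_trans (hM1 N); apply: ler_prod => j _.
    by rewrite normc_ge0 normc_1sub.
  apply: le_trans (hM2 N); apply: ler_prod => j _.
  by rewrite normc_ge0 exprSr -mulrA normc_1sub.
suff : cvgn (theta_part p x : nat -> R[i]^o) by [].
(* [M1 * M2] bounds the partial product, the last factor bounds p^(N+1) - (x + p/x). *)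
apply: (@cvg_geometric_increments _ _
  (M1 * M2 * (normc (x + p / x) + 1)) (normc p)) => // N.
have -> : theta_part p x N.+1 - theta_part p x N =
   theta_part p x N * (p ^+ N * (p ^+ N.+1 - (x + p / x))).
  rewrite /theta_part big_ord_recr /= exprS; field.
  exact: x0.
rewrite !normcM normcX mulrA [leRHS]mulrAC ler_pM ?mulr_ge0 ?exprn_ge0 ?normc_ge0 //.
  by rewrite ler_pM ?exprn_ge0 ?normc_ge0.
apply: le_trans (le_normcD _ _) _; rewrite normcN addrC lerD2l normcX.
by rewrite exprn_ile1 // ltW.
Qed.

(** * Coefficients of the truncated products *)

(** The factor x^(2N) clears the negative powers of x. All factors have the shape c + d X, so that
    one coefficient estimate and one substitution rule serve for the four of them. *)
Definition theta_poly {R : realType} (p y : R[i]) (N : nat) : {poly R[i]} :=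
  \prod_(j < N)
    ((1%:P + - (p ^+ j * y) *: 'X) * ((1%:P + - (p ^+ j / y) *: 'X) *
     (((- (p ^+ j.+1 / y))%:P + 1 *: 'X) * ((- (p ^+ j.+1 * y))%:P + 1 *: 'X)))).

Lemma theta_polyS (R : realType) (p y : R[i]) N :
  theta_poly p y N.+1 =
    (1%:P + - (p ^+ N * y) *: 'X) * ((1%:P + - (p ^+ N / y) *: 'X) *
    (((- (p ^+ N.+1 / y))%:P + 1 *: 'X) * (((- (p ^+ N.+1 * y))%:P + 1 *: 'X) *
    theta_poly p y N))).
Proof. by rewrite /theta_poly big_ord_recr /= mulrC !mulrA. Qed.

Lemma theta_poly_horner (R : realType) (p x y : R[i]) N : x != 0 -> y != 0 ->
  (theta_poly p y N).[x] =
  theta_part p (x * y) N * theta_part p (x / y) N * x ^+ (2 * N).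
Proof.
move=> x0 y0; rewrite /theta_poly /theta_part horner_prod -!big_split /=.
have -> : x ^+ (2 * N) = \prod_(j < N) x ^+ 2.
  by rewrite prodr_const card_ord exprM.
rewrite -big_split /=.
apply: eq_bigr => j _; rewrite !hornerE /=; field.
by rewrite x0 y0.
Qed.

(** For the norm given by the supremum of |P_i| r^i, multiplication by X has norm at most r; so
    multiplication by c + d X has norm at most |c| + |d| r. *)
Lemma coef_linear_mul_le (R : realType) (P : {poly R[i]}) (c d : R[i]) (r S : R) :
  0 <= r -> (forall i, normc P`_i * r ^+ i <= S) ->
  forall i, normc ((c%:P + d *: 'X) * P)`_i * r ^+ i <=
            (normc c + normc d * r) * S.
Proof.
move=> r0 hS i; rewrite mulrDl coefD coefCM -scalerAl coefZ mulrDl.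
apply: le_trans (ler_wpM2r (exprn_ge0 _ r0) (le_normcD _ _)) _.
rewrite !normcM mulrDl; apply: lerD.
  by rewrite -mulrA ler_wpM2l ?normc_ge0.
case: i => [|i].
  rewrite coefXM eqxx normc_zero mulr0 mul0r !mulr_ge0 ?normc_ge0 //.
  by apply: le_trans (hS 0); rewrite mulr_ge0 ?normc_ge0.
have -> : ('X * P)`_i.+1 = P`_i by rewrite coefXM.
rewrite exprS -!mulrA ler_wpM2l ?normc_ge0 // mulrCA ler_wpM2l //.
Qed.

(* A Cauchy estimate, uniform in N, on every circle. *)
Lemma coef_theta_poly_le (R : realType) (p y : R[i]) (r : R) :
  `|p| < 1 -> 0 < r ->
  exists M : R, forall N i,
    normc (theta_poly p y N)`_i * r ^+ i <= M * r ^+ (2 * N).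
Proof.
move=> /normc_lt1 p1 r0; have p0 := normc_ge0 _ p.
have Y0 := normc_ge0 _ y; have Yi0 : 0 <= (normc y)^-1 by rewrite invr_ge0.
set Y := normc y in Y0 Yi0.
(* With this t, each of the four linear factors of index j has norm at most 1 + |p|^j t, up to a
   factor r for the two factors with leading coefficient 1. These factors r make up r^(2N). *)
set t := (Y * r + Y^-1 * r) + (Y^-1 / r + Y / r).
have ri : 0 <= r^-1 by rewrite invr_ge0 ltW.
have r0' := ltW r0.
have t0 : 0 <= t by rewrite !addr_ge0 ?mulr_ge0.
have [M hM] := prod_geometric_bounded _ _ _ p0 p1 t0.
have prod0 N : 0 <= \prod_(j < N) (1 + normc p ^+ j * t).
  by apply: prodr_ge0 => j _; rewrite addr_ge0 ?mulr_ge0 ?exprn_ge0.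
exists (M ^+ 4) => N i.
have key : normc (theta_poly p y N)`_i * r ^+ i <=
  (\prod_(j < N) (1 + normc p ^+ j * t)) ^+ 4 * r ^+ (2 * N).
  elim: N i => [|N IH] i.
    rewrite /theta_poly !big_ord0 expr1n mul1r muln0 expr0 coef1.
    case: i => [|i]; first by rewrite eqxx normc1 expr0 mulr1.
    by rewrite [nat_of_bool _]/= mulr0n normc_zero mul0r.
  rewrite theta_polyS.
  have h1 := coef_linear_mul_le _ _ (- (p ^+ N.+1 * y)) 1 r _ r0' IH.
  have h2 := coef_linear_mul_le _ _ (- (p ^+ N.+1 / y)) 1 r _ r0' h1.
  have h3 := coef_linear_mul_le _ _ 1 (- (p ^+ N / y)) r _ r0' h2.
  have h4 := coef_linear_mul_le _ _ 1 (- (p ^+ N * y)) r _ r0' h3.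
  apply: le_trans (h4 i) _.
  rewrite !normc_opp !normc1 !normcM !normcX !normcV -/Y.
  rewrite big_ord_recr /= mulnS exprD exprMn.
  set S := \prod_(j < N) _; set Q := normc p ^+ N.
  have Q0 : 0 <= Q by rewrite exprn_ge0.
  have QS : normc p ^+ N.+1 <= Q by rewrite exprS ler_piMl // ltW.
  have QS0 : 0 <= normc p ^+ N.+1 by rewrite exprn_ge0.
  have e1 : 0 <= 1 + Q * Y * r <= 1 + Q * t.
    rewrite addr_ge0 ?mulr_ge0 //= lerD2l -mulrA ler_wpM2l // /t.
    by rewrite -addrA lerDl !addr_ge0 ?mulr_ge0.
  have e2 : 0 <= 1 + Q * Y^-1 * r <= 1 + Q * t.
    rewrite addr_ge0 ?mulr_ge0 //= lerD2l -mulrA ler_wpM2l // /t.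
    by rewrite [_ + Y^-1 * r]addrC -addrA lerDl !addr_ge0 ?mulr_ge0.
  have e3 : 0 <= normc p ^+ N.+1 * Y^-1 + 1 * r <= (1 + Q * t) * r.
    rewrite addr_ge0 ?mulr_ge0 //= mulrDl addrC lerD2l -(ler_pdivrMr _ _ r0).
    rewrite -mulrA ler_pM ?mulr_ge0 // /t.
    by rewrite addrC -addrA lerDl !addr_ge0 ?mulr_ge0.
  have e4 : 0 <= normc p ^+ N.+1 * Y + 1 * r <= (1 + Q * t) * r.
    rewrite addr_ge0 ?mulr_ge0 //= mulrDl addrC lerD2l -(ler_pdivrMr _ _ r0).
    rewrite -mulrA ler_pM ?mulr_ge0 // /t.
    by rewrite addrC [_ + Y / r]addrC -addrA lerDl !addr_ge0 ?mulr_ge0.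
  have S0 : 0 <= S ^+ 4 * r ^+ (2 * N) by rewrite mulr_ge0 ?exprn_ge0 ?prod0.
  case/andP: e1 => a1 b1; case/andP: e2 => a2 b2.
  case/andP: e3 => a3 b3; case/andP: e4 => a4 b4.
  have -> : S ^+ 4 * (1 + Q * t) ^+ 4 * (r ^+ 2 * r ^+ (2 * N)) =
    (1 + Q * t) * ((1 + Q * t) * (((1 + Q * t) * r) * (((1 + Q * t) * r) *
     (S ^+ 4 * r ^+ (2 * N))))) by ring.
  apply: (ler_pM a1 _ b1); first exact: (mulr_ge0 a2 (mulr_ge0 a3 (mulr_ge0 a4 S0))).
  apply: (ler_pM a2 _ b2); first exact: (mulr_ge0 a3 (mulr_ge0 a4 S0)).
  apply: (ler_pM a3 _ b3); first exact: (mulr_ge0 a4 S0).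
  by apply: (ler_pM a4 _ b4).
apply: le_trans key _; rewrite ler_wpM2r ?exprn_ge0 //.
by rewrite lerXn2r // nnegrE ?prod0 // (le_trans (prod0 N)).
Qed.

Lemma size_theta_poly (R : realType) (p y : R[i]) N :
  (size (theta_poly p y N) <= 4 * N + 1)%N.
Proof.
have hl (c d : R[i]) (P : {poly R[i]}) :
   (size ((c%:P + d *: 'X) * P)%R <= (size P).+1)%N.
  apply: leq_trans (size_polyMleq _ _) _.
  suff : (size (c%:P + d *: 'X)%R <= 2)%N.
    move=> h; rewrite -subn1 leq_subLR addnS.
    exact: leq_trans (leq_add h (leqnn _)) _.
  apply: leq_trans (size_polyD _ _) _; rewrite geq_max.
  rewrite (leq_trans (size_polyC_leq1 _)) //=.
  by rewrite (leq_trans (size_scale_leq _ _)) ?size_polyX.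
elim: N => [|N IH]; first by rewrite /theta_poly big_ord0 size_poly1.
rewrite theta_polyS.
have hs (c d : R[i]) (P : {poly R[i]}) k : (size P <= k)%N ->
   (size ((c%:P + d *: 'X) * P)%R <= k.+1)%N.
  by move=> Pk; rewrite (leq_trans (hl _ _ _)).
have -> : (4 * N.+1 + 1 = (4 * N + 1).+4)%N by lia.
by do 4! apply: (hs _ _ _ _ _).
Qed.

(** The induction step of [theta_poly_shift], in an abstract ring: P, Q, Y, Z stand for p, p^N, y,
    1/y, and G for the polynomial g after the substitution of pX for X. *)
Lemma theta_poly_shift_step (S : comPzRingType) (P X Q Y Z G g : S) :
  Y * Z = 1 ->
  (X ^+ 2 - Q * (Y + Z) * X + Q ^+ 2) * G =
    Q ^+ 2 * ((1 - Q * (Y + Z) * X + Q ^+ 2 * X ^+ 2) * g) ->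
  (X ^+ 2 - P * Q * (Y + Z) * X + (P * Q) ^+ 2) *
    ((1 - Q * Y * (P * X)) * ((1 - Q * Z * (P * X)) *
     ((- (P * Q * Z) + P * X) * ((- (P * Q * Y) + P * X) * G)))) =
  (P * Q) ^+ 2 * ((1 - P * Q * (Y + Z) * X + (P * Q) ^+ 2 * X ^+ 2) *
    ((1 - Q * Y * X) * ((1 - Q * Z * X) *
     ((- (P * Q * Z) + X) * ((- (P * Q * Y) + X) * g))))).
Proof.
move=> YZ IH.
have f1 c : (c - Q * Y * X) * (c - Q * Z * X) =
  c ^+ 2 - c * Q * (Y + Z) * X + Q ^+ 2 * X ^+ 2 by ring: YZ.
have f2 c : (- (c * Z) + X) * (- (c * Y) + X) =
  X ^+ 2 - c * (Y + Z) * X + c ^+ 2 by ring: YZ.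
transitivity ((X ^+ 2 - P * Q * (Y + Z) * X + (P * Q) ^+ 2) *
    ((1 - Q * Y * (P * X)) * (1 - Q * Z * (P * X))) * P ^+ 2 *
     ((- (Q * Z) + X) * (- (Q * Y) + X) * G)); first by ring.
rewrite f2 IH -f2.
transitivity (P ^+ 2 * Q ^+ 2 * (1 - P * Q * (Y + Z) * X + (P * Q) ^+ 2 * X ^+ 2) *
  ((- (P * Q * Z) + X) * (- (P * Q * Y) + X)) *
  (1 ^+ 2 - 1 * Q * (Y + Z) * X + Q ^+ 2 * X ^+ 2) * g); last by rewrite -f1; ring.
have -> : (1 - Q * Y * (P * X)) * (1 - Q * Z * (P * X)) =
   1 - P * Q * (Y + Z) * X + (P * Q) ^+ 2 * X ^+ 2 by ring: YZ.
by ring.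
Qed.

(** The truncated quasi-periodicity under x -> px. The substitution moves each linear factor to its
    neighbour, up to powers of p. The factors left over at j = 0 cancel each other; those at j = N
    are (X - p^N y)(X - p^N / y) and (1 - p^N y X)(1 - p^N X / y), here expanded. *)
Lemma theta_poly_shift (R : realType) (p y : R[i]) N : y != 0 ->
  ('X ^+ 2 - (p ^+ N * (y + y^-1))%:P * 'X + (p ^+ (2 * N))%:P) *
     (theta_poly p y N \Po (p *: 'X)) =
  (p ^+ (2 * N))%:P * ((1 - (p ^+ N * (y + y^-1))%:P * 'X +
     (p ^+ (2 * N))%:P * 'X ^+ 2) * theta_poly p y N).
Proof.
move=> y0; have yK : y%:P * (y^-1)%:P = 1 :> {poly R[i]}.
  by rewrite -polyCM divff.
elim: N => [|N IH].
  rewrite /theta_poly big_ord0 comp_polyC muln0 !expr0 !mul1r !mulr1.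
  by rewrite polyC1; ring.
have comp_lin (c d : R[i]) : (c%:P + d *: 'X) \Po (p *: 'X) = c%:P + d%:P * (p%:P * 'X).
  by rewrite comp_polyD comp_polyC comp_polyZ comp_polyX !mul_polyC.
have step := theta_poly_shift_step _ p%:P 'X (p ^+ N)%:P y%:P y^-1%:P
   (theta_poly p y N \Po (p *: 'X)) (theta_poly p y N) yK.
move: step IH; rewrite theta_polyS.
rewrite !comp_polyM !comp_lin; set G := _ \Po _; set g := theta_poly _ _ _.
have e2 : (p ^+ (2 * N.+1))%:P = (p%:P * (p ^+ N)%:P) ^+ 2.
  by rewrite -polyCM -polyC_exp -exprS mulnC exprM.
have e3 : (p ^+ (2 * N))%:P = (p ^+ N)%:P ^+ 2.
  by rewrite -polyC_exp mulnC exprM.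
rewrite e2 e3 !(exprS p N) -!mul_polyC !polyCN !polyCM !polyCD !polyC1.
move=> step IH; rewrite !mulNr !mul1r.
exact: step IH.
Qed.

Lemma coef_comp_scaleX (S : comNzRingType) (g : {poly S}) (c : S) i :
  (g \Po (c *: 'X))`_i = c ^+ i * g`_i.
Proof.
rewrite comp_polyE coef_sum.
under eq_bigr do rewrite exprZn !coefZ coefXn.
have [ig|gi] := ltnP i (size g).
  rewrite (bigD1 (Ordinal ig)) //= eqxx mulr1 mulrC big1 ?addr0 // => j ji.
  by rewrite eq_sym (negbTE (_ : val j != i)) ?mulr0.
rewrite nth_default // mulr0 big1 // => j _.
by rewrite gtn_eqF ?mulr0 // (leq_trans (ltn_ord j)).
Qed.

Lemma coef_shift_rec (S : comNzRingType) (g : {poly S}) (p a b : S) :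
  ('X ^+ 2 - a%:P * 'X + b%:P) * (g \Po (p *: 'X)) =
    b%:P * ((1 - a%:P * 'X + b%:P * 'X ^+ 2) * g) ->
  forall i, p ^+ i * g`_i - a * (p ^+ i.+1 * g`_i.+1) + b * (p ^+ i.+2 * g`_i.+2) =
    b * (g`_i.+2 - a * g`_i.+1 + b * g`_i).
Proof.
move=> /(congr1 (fun P : {poly S} => nth 0 P)) E i.
have {}E := congr1 (fun f => f i.+2) E.
rewrite !mulrDl !mulNr -!mulrA mul1r !coefCM !coefD !coefN !coefCM in E.
by rewrite !coefXM /= !coef_comp_scaleX in E.
Qed.

(* [m] and [K] encode the possibly negative exponent [i - 2 * N] as [m - K]. *)
Lemma coef_theta_poly_rec (R : realType) (p y : R[i]) N i m K :
  p != 0 -> y != 0 -> (i + K = 2 * N + m)%N ->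
  p ^+ m * (theta_poly p y N)`_i - p ^+ K * (theta_poly p y N)`_i.+2 =
  p ^+ N * ((y + y^-1) * p ^+ m.+1 * (theta_poly p y N)`_i.+1
     - p ^+ N * p ^+ m.+2 * (theta_poly p y N)`_i.+2
     - p ^+ K * (y + y^-1) * (theta_poly p y N)`_i.+1
     + p ^+ K * p ^+ N * (theta_poly p y N)`_i).
Proof.
move=> p0 y0 iK.
have E := coef_shift_rec _ _ _ _ _ (theta_poly_shift _ p y N y0) i.
move: E; set g := theta_poly p y N; set s := y + y^-1.
have b0 : p ^+ (2 * N) != 0 by rewrite expf_neq0.
move=> E; apply/eqP; rewrite -subr_eq0; apply/eqP; apply: (mulfI b0).
(* Multiplied by p^K, the recurrence contains p^i only as p^(2N) p^m, and p^(2N) can be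
   cancelled. *)
have eK : p ^+ K * p ^+ i = p ^+ (2 * N) * p ^+ m by rewrite -!exprD addnC iK.
have eb : p ^+ (2 * N) = p ^+ N * p ^+ N by rewrite -exprD addnn mul2n.
rewrite mulr0.
have {}E := congr1 (fun z => p ^+ K * z) E.
move: E; rewrite !exprS => /eqP; rewrite -subr_eq0 => /eqP E; rewrite -[RHS]E.
transitivity (p ^+ (2 * N) * p ^+ m * g`_i
   - p ^+ N * s * p * (p ^+ (2 * N) * p ^+ m) * g`_i.+1
   + p ^+ (2 * N) * (p * (p * (p ^+ (2 * N) * p ^+ m))) * g`_i.+2
   - p ^+ (2 * N) * (p ^+ K * (g`_i.+2 - p ^+ N * s * g`_i.+1 + p ^+ (2 * N) * g`_i))).
  by rewrite eb; ring.
by rewrite -eK; ring.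
Qed.

(** * The coefficients near the middle degree *)

Section Head.
Variables (R : realType) (p y : R[i]).
Hypotheses (p1 : `|p| < 1) (p0 : p != 0) (y0 : y != 0).
Variable K : nat.

(* The head of the Laurent polynomial, degrees -K to K; meant for K <= 2 * N,
   where the subtraction is not truncated. *)
Let e (m N : nat) : R[i] := (theta_poly p y N)`_(2 * N - K + m).

Lemma theta_coef_bounded : exists M : R, forall m N, normc (e m N) <= M.
Proof.
have [M hM] := coef_theta_poly_le _ p y 1 p1 ltr01.
by exists M => m N; have := hM N (2 * N - K + m)%N; rewrite !expr1n !mulr1.
Qed.

Lemma theta_coef_rec_cvg0 m :
  (((fun N => e m.+2 N - p ^+ m / p ^+ K * e m N) : nat -> R[i]^o) N
     @[N --> \oo] --> (0 : R[i]^o))%classic.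
Proof.
have [M hM] := theta_coef_bounded.
set s := y + y^-1.
(* The cofactor of p^N in [coef_theta_poly_rec], divided by - p^K; it is bounded because the
   coefficients are. *)
pose v N := - (p ^+ K)^-1 * (s * p ^+ m.+1 * e m.+1 N
     - p ^+ N * p ^+ m.+2 * e m.+2 N
     - p ^+ K * s * e m.+1 N + p ^+ K * p ^+ N * e m N).
have p1' := ltW (normc_lt1 _ _ p1).
have pX k : normc (p ^+ k) <= 1 by rewrite normcX exprn_ile1 ?normc_ge0.
have M0 : 0 <= M by rewrite (le_trans (normc_ge0 _ _) (hM 0 0)).
have vM N : normc (v N) <= normc (p ^+ K)^-1 * (normc s * M + M + normc s * M + M).
  rewrite /v normcM normc_opp ler_wpM2l ?normc_ge0 //.
  have hh (a b : R[i]) l : normc (b) <= M -> normc (a * p ^+ l * b) <= normc a * M.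
    by move=> hb; rewrite !normcM ler_pM ?mulr_ge0 ?normc_ge0 // ler_piMr ?normc_ge0.
  have h1 (b : R[i]) l j : normc b <= M -> normc (p ^+ l * p ^+ j * b) <= M.
    move=> hb; apply: le_trans (hh _ _ _ hb) _; rewrite ler_piMl //.
  apply: le_trans (le_normcD _ _) _; apply: lerD; last exact: h1.
  apply: le_trans (le_normcD _ _) _; apply: lerD; last first.
    by rewrite normc_opp [p ^+ K * s]mulrC; apply: hh.
  apply: le_trans (le_normcD _ _) _; rewrite normc_opp; apply: lerD.
    exact: hh.
  exact: h1.
have := cvg_bounded_mul0 _ _ _ _ vM (cvg_expC0 _ _ p1).
apply: cvg_trans; apply: near_eq_cvg; near=> N.
have KN : (K <= 2 * N)%N.
  by rewrite (@leq_trans N) ?leq_pmull //; near: N; exact: nbhs_infty_ge.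
have iK : (2 * N - K + m + K = 2 * N + m)%N by lia.
have := coef_theta_poly_rec _ p y N _ _ _ p0 y0 iK.
rewrite -!addnS -/s => E; rewrite /v mulrCA /e -E.
have pK0 : p ^+ K != 0 by rewrite expf_neq0.
by field.
Unshelve. all: by end_near. Qed.

(** The solution of the limiting recurrence c_(m+2) = p^(m-K) c_m with c_0 = c_1 = 1, both covered
    by the default branch. It does not involve y. *)
Fixpoint shift_coef (m : nat) : R[i] :=
  if m is m'.+2 then p ^+ m' / p ^+ K * shift_coef m' else 1.

Lemma theta_coef_approx m :
  (((fun N => e m N - shift_coef m * e (odd m) N) : nat -> R[i]^o) N
     @[N --> \oo] --> (0 : R[i]^o))%classic.
Proof.
have [n] := ubnP m; elim: n m => // n IH [|[|m]] mn.
- rewrite /shift_coef; under eq_fun do rewrite mul1r subrr; exact: cvg_cst.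
- rewrite /shift_coef; under eq_fun do rewrite mul1r subrr; exact: cvg_cst.
have {}IH := IH m (ltnW mn).
have -> : odd m.+2 = odd m by rewrite /= negbK.
have {}IH := cvg_bounded_mul0 _ _ (fun=> p ^+ m / p ^+ K) _ (fun=> lexx _) IH.
apply: cvg_trans (cvg0D _ _ _ (theta_coef_rec_cvg0 m) IH); apply: near_eq_cvg.
by apply: nearW => N /=; ring.
Qed.

(** With powers of x for [xs], the two sums depend on x only, while [e 0 N] and [e 1 N] depend on y
    only: this is the approximation by functions of rank two. *)
Lemma theta_head_rank2 (xs : nat -> R[i]) (n : nat) :
  (((fun N => \sum_(m < n) e m N * xs m -
      (e 0 N * (\sum_(m < n | ~~ odd m) shift_coef m * xs m) +
       e 1 N * (\sum_(m < n | odd m) shift_coef m * xs m))) : nat -> R[i]^o) N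
     @[N --> \oo] --> (0 : R[i]^o))%classic.
Proof.
elim: n => [|n IH].
  under eq_fun do rewrite !big_ord0 !mulr0 addr0 subrr; exact: cvg_cst.
have h := cvg_bounded_mul0 _ _ (fun=> xs n) _ (fun=> lexx _) (theta_coef_approx n).
apply: cvg_trans (cvg0D _ _ _ IH h); apply: near_eq_cvg.
apply: nearW => N.
have rec (Q : pred nat) (F : nat -> R[i]) : \sum_(m < n.+1 | Q m) F m =
    \sum_(m < n | Q m) F m + (if Q n then F n else 0).
  by rewrite big_mkcond big_ord_recr -big_mkcond.
rewrite big_ord_recr /= (rec (fun m => ~~ odd m) (fun m => shift_coef m * xs m)).
rewrite (rec odd (fun m => shift_coef m * xs m)).
by case: (odd n) => /=; rewrite ?addr0; ring.
Qed.
End Head.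

(** * The coefficients far from the middle degree *)

Lemma sum_pow2_le (R : realType) n : \sum_(i < n) (2 : R) ^+ i <= 2 ^+ n.
Proof.
elim: n => [|n IH]; first by rewrite big_ord0 expr0.
by rewrite big_ord_recr exprS mulr_natl mulr2n /= lerD2r.
Qed.

Lemma sum_powN2_le (R : realType) a n :
  \sum_(i < n) ((2 : R) ^+ (a.+1 + i))^-1 <= (2 ^+ a)^-1.
Proof.
suff -> : \sum_(i < n) ((2 : R) ^+ (a.+1 + i))^-1 = (2 ^+ a)^-1 - (2 ^+ (a + n))^-1.
  by rewrite gerBl invr_ge0 exprn_ge0.
elim: n => [|n IH]; first by rewrite big_ord0 addn0 subrr.
rewrite big_ord_recr /= IH addnS addSn exprS invfM.
by field; rewrite !expf_neq0 // pnatr_eq0.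
Qed.

Lemma sum_ord3 (V : zmodType) (F : nat -> V) a b c :
  \sum_(i < a + (b + c)) F i =
  \sum_(i < a) F i + (\sum_(i < b) F (a + i)%N + \sum_(i < c) F (a + (b + i))%N).
Proof. by rewrite !big_split_ord. Qed.

(** The Cauchy estimate on the circle of radius |x|/2 makes the terms of low degree decay like
    powers of 2 away from degree 2N; the circle of radius 2|x| does the same for high degrees. The
    constants do not depend on N. *)
Lemma theta_tail (R : realType) (p x y : R[i]) :
  `|p| < 1 -> x != 0 -> y != 0 ->
  exists M : R, forall K N, (K <= 2 * N)%N ->
    normc (theta_part p (x * y) N * theta_part p (x / y) N -
      \sum_(m < 2 * K + 1) (theta_poly p y N)`_(2 * N - K + m) * (x ^+ m / x ^+ K))
    <= M / 2 ^+ K.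
Proof.
move=> p1 x0 y0.
have X0 : 0 < normc x.
  by rewrite lt_neqAle normc_ge0 andbT eq_sym; apply: contraNN x0 => /eqP/eq0_normc ->.
have [M1 h1] := coef_theta_poly_le _ p y _ p1 (divr_gt0 X0 (ltr0Sn R 1)).
have [M2 h2] := coef_theta_poly_le _ p y _ p1 (mulr_gt0 X0 (ltr0Sn R 1)).
exists (M1 + M2) => K N KN.
have XN : 0 < normc x ^+ (2 * N) by rewrite exprn_gt0.
have two k : 0 < (2 : R) ^+ k by rewrite exprn_gt0.
have -> : theta_part p (x * y) N * theta_part p (x / y) N =
    (theta_poly p y N).[x] / x ^+ (2 * N).
  by rewrite theta_poly_horner // mulfK // expf_neq0.
rewrite (horner_coef_wide _ (size_theta_poly _ _ _ _)).
set g := theta_poly p y N.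
(* Low degrees, the 2K + 1 middle degrees, and high degrees. *)
have -> : (4 * N + 1 = (2 * N - K) + ((2 * K + 1) + (2 * N - K)))%N by lia.
rewrite (sum_ord3 _ (fun i => g`_i * x ^+ i)) !mulrDl !mulr_suml.
have -> : \sum_(i < 2 * K + 1) g`_(2 * N - K + i) * x ^+ (2 * N - K + i) / x ^+ (2 * N)
  = \sum_(m < 2 * K + 1) g`_(2 * N - K + m) * (x ^+ m / x ^+ K).
  apply: eq_bigr => i _; rewrite -mulrA; congr (_ * _).
  rewrite -[in RHS](mulfK (expf_neq0 (2 * N - K) x0) (x ^+ i)) mulrAC -mulrA -invfM.
  by rewrite -!exprD addnC subnKC // addnC.
rewrite [X in normc (X - _)]addrCA addrAC subrr add0r.
apply: le_trans (le_normcD _ _) _; apply: lerD.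
  apply: le_trans (normc_sum _ _ _ _) _.
  apply: (@le_trans _ _ (\sum_(i < 2 * N - K) M1 / 2 ^+ (2 * N) * 2 ^+ i)).
    apply: ler_sum => i _; rewrite !normcM normcV !normcX ler_pdivrMr //.
    have := h1 N i; rewrite !expr_div_n mulrA ler_pdivrMr ?two // => h.
    by apply: le_trans h _; rewrite le_eqVlt; apply/orP; left; apply/eqP; ring.
  have M10 : 0 <= M1.
    have := h1 0%N 0%N; rewrite !expr0 !mulr1; apply: le_trans.
    exact: normc_ge0.
  rewrite -mulr_sumr; apply: le_trans (ler_wpM2l _ (sum_pow2_le _ _)) _.
    by rewrite divr_ge0 // ltW.
  rewrite -mulrA ler_wpM2l // -{1}(subnK KN) exprD.
  by rewrite invfM mulrAC mulVf ?mul1r // lt0r_neq0.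
apply: le_trans (normc_sum _ _ _ _) _.
have M20 : 0 <= M2.
  have := h2 0%N 0%N; rewrite !expr0 !mulr1; apply: le_trans.
  exact: normc_ge0.
have e : (2 * N - K + (2 * K + 1) = (2 * N + K).+1)%N by lia.
apply: (@le_trans _ _ (\sum_(i < 2 * N - K) M2 * 2 ^+ (2 * N) * (2 ^+ ((2 * N + K).+1 + i))^-1)).
  apply: ler_sum => i _; rewrite addnA e !normcM normcV !normcX ler_pdivrMr //.
  rewrite mulrAC ler_pdivlMr ?two //.
  have := h2 N ((2 * N + K).+1 + i)%N; rewrite !exprMn mulrA => h.
  by apply: le_trans h _; rewrite le_eqVlt; apply/orP; left; apply/eqP; ring.
rewrite -mulr_sumr; apply: le_trans (ler_wpM2l _ (sum_powN2_le _ _ _)) _.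
  by rewrite mulr_ge0 // ltW.
rewrite -mulrA ler_wpM2l // exprD.
by rewrite invfM mulrA divff ?mul1r // lt0r_neq0.
Qed.

(** * The addition formula *)

Definition theta2 {R : realType} (p x y : R[i]) : R[i] :=
  theta p (x * y) * theta p (x / y).

Lemma theta2_cvg (R : realType) (p x y : R[i]) :
  `|p| < 1 -> x != 0 -> y != 0 ->
  (((fun N => theta_part p (x * y) N * theta_part p (x / y) N) : nat -> R[i]^o) N
     @[N --> \oo] --> (theta2 p x y : R[i]^o))%classic.
Proof.
move=> p1 x0 y0.
apply: (@cvgM R[i]); apply: theta_cvg => //; rewrite ?mulf_neq0 ?invr_neq0 //.
Qed.

Lemma normc_lt_thirds (R : realType) (f F H L : R[i]) (e : R) :
  normc (F - H) < e / 3 -> normc (f - F) < e / 3 -> normc (H - L) < e / 3 ->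
  normc (f - L) < e.
Proof.
move=> k1 k3 k4; have -> : f - L = (f - F) + ((F - H) + (H - L)) by ring.
rewrite (_ : e = e / 3 + (e / 3 + e / 3)); last by field.
apply: le_lt_trans (le_normcD _ _) _; apply: ltrD k3 _.
by apply: le_lt_trans (le_normcD _ _) _; apply: ltrD k4.
Qed.

(** One third of [e] each goes to the convergence of the truncated products, to the outer
    coefficients and to the middle ones. *)
Lemma theta2_rank2_approx (R : realType) (p : R[i]) (xs ys : 'I_3 -> R[i]) (e : R) :
  `|p| < 1 -> p != 0 -> (forall i, xs i != 0) -> (forall j, ys j != 0) -> 0 < e ->
  exists (A0 A1 c0 c1 : 'I_3 -> R[i]), forall i j,
    normc (theta2 p (xs i) (ys j) - (c0 j * A0 i + c1 j * A1 i)) < e.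
Proof.
move=> p1 p0 xs0 ys0 e0.
have e3 : 0 < e / 3 by rewrite divr_gt0.
have /boolp.choice[M hM] : forall ij : 'I_3 * 'I_3, exists M : R,
    forall K N, (K <= 2 * N)%N ->
    normc (theta_part p (xs ij.1 * ys ij.2) N * theta_part p (xs ij.1 / ys ij.2) N -
      \sum_(m < 2 * K + 1) (theta_poly p (ys ij.2) N)`_(2 * N - K + m)
         * (xs ij.1 ^+ m / xs ij.1 ^+ K)) <= M / 2 ^+ K.
  by move=> ij; exact: theta_tail.
(* K is fixed first, for all nine pairs at once; N is then taken large for this K. *)
have [K hK] : exists K, forall ij, M ij / 2 ^+ K < e / 3.
  have half : `|2^-1 : R| < 1 by rewrite ger0_norm ?invr_ge0 // invf_lt1 // ltr1n.
  have : (\forall K \near \oo, forall ij, M ij / 2 ^+ K < e / 3)%classic.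
    apply: filter_forall => ij.
    have /cvgrPdist_lt/(_ _ e3) := @cvg_geometric R (M ij) _ half.
    apply: filterS => K; rewrite sub0r normrN /geometric /= exprVn.
    by apply: le_lt_trans; exact: ler_norm.
  by move=> [K _ hK]; exists K; apply: (hK K) => /=.
pose c b j N := (theta_poly p (ys j) N)`_(2 * N - K + b).
pose A b i := \sum_(m < 2 * K + 1 | odd m == b) shift_coef _ p K m * (xs i ^+ m / xs i ^+ K).
have [N hN] : exists N, forall ij : 'I_3 * 'I_3,
   normc (theta2 p (xs ij.1) (ys ij.2) - (c 0%N ij.2 N * A false ij.1 + c 1%N ij.2 N * A true ij.1)) < e.
  have : (\forall N \near \oo, forall ij : 'I_3 * 'I_3,
     normc (theta2 p (xs ij.1) (ys ij.2) - (c 0%N ij.2 N * A false ij.1 + c 1%N ij.2 N * A true ij.1)) < e)%classic.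
    apply: filter_forall => -[i j] /=.
    have h1 := (cvg_normcP _ _ _).1 (theta2_cvg _ _ _ _ p1 (xs0 i) (ys0 j)) _ e3.
    have h2 := (cvg_normcP _ _ _).1
      (theta_head_rank2 _ _ _ p1 p0 (ys0 j) K (fun m => xs i ^+ m / xs i ^+ K) (2 * K + 1)) _ e3.
    near=> N.
    have KN : (K <= 2 * N)%N.
      by rewrite (@leq_trans N) ?leq_pmull //; near: N; exact: nbhs_infty_ge.
    have k1 := hM (i, j) K N KN; have k2 := hK (i, j).
    have k3 : normc (theta2 p (xs i) (ys j) -
       theta_part p (xs i * ys j) N * theta_part p (xs i / ys j) N) < e / 3.
      by near: N.
    have k4 : normc (0 - (\sum_(m < 2 * K + 1) (theta_poly p (ys j) N)`_(2 * N - K + m)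
       * (xs i ^+ m / xs i ^+ K)
       - (c 0%N j N * A false i + c 1%N j N * A true i))) < e / 3.
      have -> : A false i = \sum_(m < 2 * K + 1 | ~~ odd m) shift_coef _ p K m * (xs i ^+ m / xs i ^+ K).
        by apply: eq_bigl => m; rewrite eqbF_neg.
      have -> : A true i = \sum_(m < 2 * K + 1 | odd m) shift_coef _ p K m * (xs i ^+ m / xs i ^+ K).
        by apply: eq_bigl => m; rewrite eqb_id.
      by near: N.
    move: k4; rewrite sub0r normc_opp; move: (le_lt_trans k1 k2) k3.
    exact: normc_lt_thirds.
  by move=> [N _ hN]; exists N; apply: (hN N) => /=.
exists (A false), (A true), (fun j => c 0%N j N), (fun j => c 1%N j N) => i j.
exact: (hN (i, j)).
Unshelve. all: by end_near. Qed.

Definition det3 {S : pzRingType} (f : 'I_3 -> 'I_3 -> S) : S :=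
  let i0 := inord 0 : 'I_3 in let i1 := inord 1 : 'I_3 in let i2 := inord 2 : 'I_3 in
  f i0 i0 * (f i1 i1 * f i2 i2 - f i1 i2 * f i2 i1)
  - f i0 i1 * (f i1 i0 * f i2 i2 - f i1 i2 * f i2 i0)
  + f i0 i2 * (f i1 i0 * f i2 i1 - f i1 i1 * f i2 i0).

(** The determinant is continuous in its entries and vanishes on matrices of rank two. *)
Lemma det3_rank2_approx (R : realType) (f : 'I_3 -> 'I_3 -> R[i]) :
  (forall e : R, 0 < e -> exists (A0 A1 c0 c1 : 'I_3 -> R[i]), forall i j,
    normc (f i j - (c0 j * A0 i + c1 j * A1 i)) < e) ->
  det3 f = 0.
Proof.
move=> h.
have /boolp.choice[L hL] : forall n : nat, exists L : 'I_3 -> 'I_3 -> R[i],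
    det3 L = 0 /\ forall i j, normc (f i j - L i j) < n.+1%:R^-1.
  move=> n; have [|A0 [A1 [c0 [c1 hA]]]] := h n.+1%:R^-1; first by rewrite invr_gt0.
  by exists (fun i j => c0 j * A0 i + c1 j * A1 i); split => //; rewrite /det3; ring.
have Lf i j : (((fun n => L n i j) : nat -> R[i]^o) n @[n --> \oo] --> (f i j : R[i]^o))%classic.
  apply/cvg_normcP => e e0; near=> n.
  apply: lt_trans ((hL n).2 i j) _; near: n; exact: near_infty_natSinv_lt (PosNum e0).
have cf : ((fun n => det3 (L n) : R[i]^o) n @[n --> \oo] --> (det3 f : R[i]^o))%classic.
  by rewrite /det3; apply: cvgD; [apply: cvgB|]; (apply: (@cvgM R[i]);
    [exact: Lf | apply: cvgB; apply: (@cvgM R[i]); exact: Lf]).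
have : ((fun n => det3 (L n) : R[i]^o) n @[n --> \oo] --> (0 : R[i]^o))%classic.
  by under eq_fun do rewrite (hL _).1; exact: cvg_cst.
by move=> c0; exact: (cvg_unique _ cf c0).
Unshelve. all: by end_near. Qed.

(** Inverting x exchanges the two families of factors up to a shift of the index, so only end
    factors differ. In the limit they become x and 1, which gives [thetaV]. *)
Lemma theta_part_inv (R : realType) (p x : R[i]) N : x != 0 ->
  theta_part p x^-1 N * (x - p ^+ N) = - (theta_part p x N * (1 - p ^+ N * x)).
Proof.
move=> x0; elim: N => [|N IH].
  by rewrite /theta_part !big_ord0 expr0 !mul1r opprB.
rewrite /theta_part !big_ord_recr /= -/(theta_part p x^-1 N) -/(theta_part p x N).
transitivity (theta_part p x^-1 N * (x - p ^+ N) * ((1 - p ^+ N.+1 * x) * (1 - p ^+ N.+1 / x))).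
  by rewrite invrK exprS; field.
by rewrite IH; ring.
Qed.

Lemma thetaV (R : realType) (p x : R[i]) : `|p| < 1 -> x != 0 ->
  theta p x^-1 = - (theta p x / x).
Proof.
move=> p1 x0; have xi0 : x^-1 != 0 by rewrite invr_neq0.
have cl : ((fun N => theta_part p x^-1 N * (x - p ^+ N) : R[i]^o) N @[N --> \oo]
    --> (theta p x^-1 * (x - 0) : R[i]^o))%classic.
  apply: (@cvgM R[i]); first exact: theta_cvg.
  by apply: cvgB; [exact: cvg_cst | exact: cvg_expC0].
have cr : ((fun N => - (theta_part p x N * (1 - p ^+ N * x)) : R[i]^o) N @[N --> \oo]
    --> (- (theta p x * (1 - 0 * x)) : R[i]^o))%classic.
  apply: cvgN; apply: (@cvgM R[i]); first exact: theta_cvg.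
  apply: cvgB; first exact: cvg_cst.
  by apply: (@cvgM R[i]); [exact: cvg_expC0 | exact: cvg_cst].
have E : theta p x^-1 * (x - 0) = - (theta p x * (1 - 0 * x)).
  have cr' : ((fun N => theta_part p x^-1 N * (x - p ^+ N) : R[i]^o) N @[N --> \oo]
      --> (- (theta p x * (1 - 0 * x)) : R[i]^o))%classic.
    apply: cvg_trans cr; apply: near_eq_cvg.
    by apply: nearW => N; rewrite theta_part_inv.
  exact: (cvg_unique _ cl cr').
apply: (mulIf x0); move: E; rewrite subr0 mul0r subr0 mulr1 => ->.
by rewrite mulNr mulfVK.
Qed.

(** The recurrence for the coefficients divides by powers of p, so p = 0 is treated apart; there
    only the factor of index 0 differs from 1. *)
Lemma theta0p (R : realType) (x : R[i]) : x != 0 -> theta 0 x = 1 - x.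
Proof.
move=> x0; have p1 : `|0 : R[i]| < 1 by rewrite normr0.
have c1 : ((theta_part 0 x : nat -> R[i]^o) N @[N --> \oo] --> (1 - x : R[i]^o))%classic.
  apply: (@cvg_near_cst _ (R[i]^o)); exists 1%N => // -[//|N] _ /=.
  rewrite /theta_part big_ord_recl big1 ?mulr1.
    by rewrite expr0 mul1r expr1 !mul0r subr0 mulr1.
  by move=> i _; rewrite !expr0n !mul0r subr0 mulr1.
exact: (cvg_unique _ (theta_cvg _ _ _ p1 x0) c1).
Qed.

Definition theta_alt {R : realType} (p x y : R[i]) : R[i] := theta2 p x y / x.

Lemma theta_alt_antisym (R : realType) (p x y : R[i]) :
  `|p| < 1 -> x != 0 -> y != 0 -> theta_alt p y x = - theta_alt p x y.
Proof.
move=> p1 x0 y0; rewrite /theta_alt /theta2 (mulrC y x) -(invf_div x y) thetaV //.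
  by field; rewrite x0.
by rewrite mulf_neq0 ?invr_neq0.
Qed.

Lemma theta2_det3 (R : realType) (p : R[i]) (xs ys : 'I_3 -> R[i]) :
  `|p| < 1 -> p != 0 -> (forall i, xs i != 0) -> (forall j, ys j != 0) ->
  det3 (fun i j => theta2 p (xs i) (ys j)) = 0.
Proof.
by move=> p1 p0 xs0 ys0; apply: det3_rank2_approx => e; exact: theta2_rank2_approx.
Qed.

Lemma theta_alt_pfaffian_mul (R : realType) (p x y u v : R[i]) :
  `|p| < 1 -> x != 0 -> y != 0 -> u != 0 -> v != 0 ->
  theta_alt p x y * (theta_alt p x y * theta_alt p u v - theta_alt p x u * theta_alt p y v
    + theta_alt p x v * theta_alt p y u) = 0.
Proof.
move=> p1 x0 y0 u0 v0; have [->|p0] := eqVneq p 0.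
  rewrite /theta_alt /theta2 !theta0p ?mulf_neq0 ?invr_neq0 //; field.
  by rewrite x0 y0 u0 v0.
(* The minor of rows x, y, u and columns x, y, v is theta_alt p x y times the
   Pfaffian, as the matrix is alternating. *)
pose xs := fun i : 'I_3 => nth 1 [:: x; y; u] i.
pose ys := fun i : 'I_3 => nth 1 [:: x; y; v] i.
have xs0 i : xs i != 0 by case: i => -[|[|[|i]]] //=.
have ys0 i : ys i != 0 by case: i => -[|[|[|i]]] //=.
have := theta2_det3 _ p xs ys p1 p0 xs0 ys0.
rewrite /det3 /xs /ys !inordK //=.
have tE a b : a != 0 -> theta2 p a b = a * theta_alt p a b.
  by move=> a0; rewrite /theta_alt mulrC divfK.
have diag a : a != 0 -> theta_alt p a a = 0.
  move=> a0; apply/eqP; have /eqP := theta_alt_antisym _ p a a p1 a0 a0.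
  by rewrite -subr_eq0 opprK -mulr2n mulrn_eq0.
rewrite !tE // !diag // (theta_alt_antisym _ p x y) // (theta_alt_antisym _ p x u) // (theta_alt_antisym _ p y u) //.
(* The rows of the minor of [theta2] carry the factors x, y and u. *)
move=> E; apply: (mulfI x0); apply: (mulfI y0); apply: (mulfI u0).
by rewrite !mulr0 -[RHS]E; ring.
Qed.

(** Each term contains one of the entries pairing x with y, u or v. If one of these is nonzero, it
    can be cancelled in [theta_alt_pfaffian_mul], up to a permutation of the points; otherwise all
    terms vanish. *)
Lemma theta_alt_pfaffian (R : realType) (p x y u v : R[i]) :
  `|p| < 1 -> x != 0 -> y != 0 -> u != 0 -> v != 0 ->
  theta_alt p x y * theta_alt p u v - theta_alt p x u * theta_alt p y v + theta_alt p x v * theta_alt p y u = 0.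
Proof.
move=> p1 x0 y0 u0 v0.
have h1 := theta_alt_pfaffian_mul _ _ _ _ _ _ p1 x0 y0 u0 v0.
have h2 := theta_alt_pfaffian_mul _ _ _ _ _ _ p1 x0 u0 y0 v0.
have h3 := theta_alt_pfaffian_mul _ _ _ _ _ _ p1 x0 v0 y0 u0.
move: h1 h2 h3; rewrite (theta_alt_antisym _ p y u) // (theta_alt_antisym _ p u v) // (theta_alt_antisym _ p y v) //.
set a := theta_alt p x y; set b := theta_alt p x u; set c := theta_alt p x v.
set d := theta_alt p y u; set e := theta_alt p y v; set f := theta_alt p u v.
have [->|a0] := eqVneq a 0; last first.
  by move=> h _ _; apply: (mulfI a0); rewrite mulr0.
have [->|b0] := eqVneq b 0; last first.
  move=> _ h _; apply: (mulfI b0); apply: oppr_inj.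
  by rewrite mulr0 oppr0 -[RHS]h; ring.
have [->|c0] := eqVneq c 0; last first.
  move=> _ _ h; apply: (mulfI c0); rewrite mulr0 -[RHS]h; ring.
by move=> _ _ _; rewrite !mul0r subrr addr0.
Qed.

(** Stated in the variables of the elliptic numbers: X will be q^(z-N), and A, B the shifted
    parameters a q^(2N), b q^N. *)
Lemma theta_addition (R : realType) (p X A B q : R[i]) :
  `|p| < 1 -> X != 0 -> A != 0 -> B != 0 -> q != 0 ->
  theta p (X * q) * theta p (A * X / q) * theta p (B * q) * theta p (A / (B * q)) =
  theta p q * theta p (A / q) * theta p (B * X * q) * theta p (A * X / (B * q)) +
  q * (theta p X * theta p (A * X) * theta p B * theta p (A / (B * q ^+ 2))).
Proof.
move=> p1 X0 A0 B0 q0.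
(* The Pfaffian at the four points X u, q / u, u and B q / u, where u^2 = A. *)
have [u uu] : exists u, A = u * u by exists (sqrtc A); rewrite -expr2 sqr_sqrtc.
have u0 : u != 0 by apply: contraNneq A0 => u0; rewrite uu u0 mulr0.
have := theta_alt_pfaffian _ p (X * u) (q / u) u (B * q / u) p1.
rewrite !mulf_neq0 ?invr_neq0 // => /(_ isT isT u0 isT).
rewrite /theta_alt /theta2.
have -> : X * u * (q / u) = X * q by field.
have -> : X * u / (q / u) = A * X / q by rewrite uu; field; rewrite q0.
have -> : u * (B * q / u) = B * q by field.
have -> : u / (B * q / u) = A / (B * q) by rewrite uu; field; rewrite ?q0 ?B0.
have -> : X * u * u = A * X by rewrite uu; ring.
have -> : X * u / u = X by field.
have -> : q / u * (B * q / u) = (A / (B * q ^+ 2))^-1.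
  by rewrite uu; field; rewrite ?q0 ?B0 ?u0.
have -> : q / u / (B * q / u) = B^-1 by field; rewrite ?q0 ?B0 ?u0.
have -> : X * u * (B * q / u) = B * X * q by field.
have -> : X * u / (B * q / u) = A * X / (B * q) by rewrite uu; field; rewrite ?q0 ?B0.
have -> : q / u * u = q by field.
have -> : q / u / u = (A / q)^-1 by rewrite uu; field; rewrite ?q0 ?B0 ?u0.
rewrite !thetaV ?mulf_neq0 ?invr_neq0 ?mulf_neq0 ?expf_neq0 //.
move=> E; apply/eqP; rewrite -subr_eq0; apply/eqP.
(* The Pfaffian is the difference of the two sides divided by X A. *)
apply: (mulfI (_ : (X * A)^-1 != 0)); first by rewrite invr_neq0 ?mulf_neq0.
rewrite mulr0 -[RHS]E uu; field.
by rewrite ?X0 ?B0 ?q0 ?u0.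
Qed.

(** * Elliptic numbers *)

Lemma expCD (R : realType) (z w : R[i]) : expC (z + w) = expC z * expC w.
Proof.
case: z => a b; case: w => c d; rewrite /expC /= expRD cosD sinD.
by apply/eqP; rewrite eq_complex /=; apply/andP; split; apply/eqP; ring.
Qed.

Lemma expC0 (R : realType) : expC (0 : R[i]) = 1.
Proof. by rewrite /expC /= expR0 cos0 sin0 mul1r. Qed.

Lemma expC_neq0 (R : realType) (z : R[i]) : expC z != 0.
Proof.
have : expC z * expC (- z) != 0 by rewrite -expCD subrr expC0 oner_neq0.
by apply: contraNneq => ->; rewrite mul0r.
Qed.

Lemma expCN (R : realType) (z : R[i]) : expC (- z) = (expC z)^-1.
Proof.
apply: (mulfI (expC_neq0 _ z)).
by rewrite -expCD subrr expC0 divff ?expC_neq0.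
Qed.

Lemma expC_int (R : realType) (l : R[i]) (N : int) : expC (l * N%:~R) = expC l ^ N.
Proof.
have nat n : expC (l * n%:R) = expC l ^+ n.
  elim: n => [|n IH]; first by rewrite mulr0 expC0.
  by rewrite -natr1 mulrDr mulr1 expCD IH exprSr.
case: N => n; first exact: nat.
rewrite NegzE mulrNz mulrN expCN. rewrite (nat n.+1). by rewrite exprnN.
Qed.

Lemma qpow_subz (R : realType) (l z : R[i]) (N : int) :
  qpow l (z - N%:~R) = qpow l z / expC l ^ N.
Proof. by rewrite /qpow mulrBr expCD expCN expC_int. Qed.

Lemma thetas3 (R : realType) (p x y t : R[i]) :
  thetas p [:: x; y; t] = theta p x * theta p y * theta p t.
Proof. by rewrite /thetas !big_cons big_nil mulr1 !mulrA. Qed.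

Lemma thetas4 (R : realType) (p x y t u : R[i]) :
  thetas p [:: x; y; t; u] = theta p x * theta p y * theta p t * theta p u.
Proof. by rewrite /thetas !big_cons big_nil mulr1 !mulrA. Qed.

(** The index is an integer because the left-hand product of the theorem uses N = i - h_i, which may
    be negative; the right-hand products use N = j. *)
Definition ellfactor {R : realType} (l p a b z : R[i]) (N : int) : R[i] :=
  ellnum l p (a * expC l ^ (2 * N)) (b * expC l ^ N) (z - N%:~R).

Section EllipticStep.
Variables (R : realType) (l p a b z : R[i]).
Let q := expC l.
Let x := qpow l z.
Hypotheses (p1 : `|p| < 1) (a0 : a != 0) (b0 : b != 0).

Let q0 : q != 0. Proof. exact: expC_neq0. Qed.
Let x0 : x != 0. Proof. exact: expC_neq0. Qed.

Lemma exprz_2mul N : q ^ (2 * N) = (q ^ N) ^+ 2.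
Proof. by rewrite exprnP exprz_exp mulrC. Qed.

Lemma ellfactor_denE N :
  ellnum_den l p (a * q ^ (2 * N)) (b * q ^ N) (z - N%:~R) =
  theta p q * theta p (a * q ^ (2 * N + 1)) * theta p (b * x * q) *
  theta p (a * x / (b * q)).
Proof.
have QN : q ^ N != 0 by rewrite expfz_neq0.
rewrite /ellnum_den thetas4 -/q.
have -> : z - N%:~R + 1 = z - (N - 1)%:~R by rewrite intrD rmorphN /= opprD addrA opprK.
have -> : z - N%:~R - 1 = z - (N + 1)%:~R by rewrite intrD /= opprD addrA.
rewrite !qpow_subz -/q -/x !expfzDr // exprz_2mul !expr1z exprN1.
by congr (_ * theta p _ * theta p _ * theta p _); field; rewrite ?q0 ?QN ?b0.
Qed.

Lemma ellfactor_numE N :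
  ellnum_num l p (a * q ^ (2 * N)) (b * q ^ N) (z - N%:~R) =
  theta p (x / q ^ N) * theta p (a * x * q ^ N) * theta p (b * q ^ N * q ^+ 2) *
  theta p (a * q ^ N / b).
Proof.
have QN : q ^ N != 0 by rewrite expfz_neq0.
rewrite /ellnum_num thetas4 -/q !qpow_subz -/q -/x exprz_2mul.
by congr (_ * theta p _ * _ * theta p _); field; rewrite ?q0 ?QN ?b0.
Qed.

Lemma weight_den_theta N : weight_den q p a b N != 0 ->
  theta p (a * q ^ (2 * (N - 1) + 1)) != 0.
Proof.
rewrite /weight_den thetas3 !mulf_eq0 !negb_or => /andP[/andP[h _] _].
by rewrite mulrBr -addrA.
Qed.

Hypotheses (gq : theta p q != 0) (gb : theta p (b * x * q) != 0)
  (ga : theta p (a * x / (b * q)) != 0).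

(** The left side of [theta_addition] is the numerator of E(N-1), and its first term on the right is
    the denominator; the quotient of the second term by this denominator is w(N) E(N). *)
Lemma ellfactor_step N :
  theta p (a * q ^ (2 * N + 1)) != 0 -> weight_den q p a b N != 0 ->
  ellfactor l p a b z (N - 1) = 1 + weight q p a b N * ellfactor l p a b z N.
Proof.
move=> gN wN; have gN1 := weight_den_theta _ wN.
rewrite /ellfactor /ellnum !ellfactor_denE !ellfactor_numE -/q.
rewrite /weight; move: wN; rewrite /weight_den /weight_num !thetas3.
rewrite !mulf_eq0 !negb_or => /andP[/andP[w1 w2] w3].
have QN : q ^ N != 0 by rewrite expfz_neq0.
set Q := q ^ N in QN *.
have e1 : q ^ (N - 1) = Q / q by rewrite expfzDr // exprN1.
have e2 : q ^ (N + 2) = Q * q ^+ 2 by rewrite expfzDr.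
have e3 : q ^ (N - 2) = Q / q ^+ 2 by rewrite expfzDr.
have e4 : q ^ (2 * (N - 1) + 1) = Q ^+ 2 / q.
  by rewrite !expfzDr // exprz_2mul e1 expr1z; field.
have e5 : q ^ (2 * N - 1) = Q ^+ 2 / q.
  by rewrite expfzDr // exprz_2mul exprN1.
have e6 : q ^ (2 * N + 1) = Q ^+ 2 * q by rewrite expfzDr // exprz_2mul expr1z.
rewrite !(e1, e2, e3, e4, e5, e6) in gN gN1 w1 w2 w3 *.
have := theta_addition _ p (x / Q) (a * Q ^+ 2) (b * Q) q p1
  (mulf_neq0 x0 (invr_neq0 QN)) (mulf_neq0 a0 (expf_neq0 2 QN)) (mulf_neq0 b0 QN) q0.
have -> : x / Q * q = x / (Q / q) by field; rewrite ?q0 ?QN.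
have -> : a * Q ^+ 2 * (x / Q) / q = a * x * (Q / q) by field; rewrite ?q0 ?QN.
have -> : b * Q * q = b * (Q / q) * q ^+ 2 by field.
have -> : a * Q ^+ 2 / (b * (Q / q) * q ^+ 2) = a * (Q / q) / b.
  by field; rewrite ?q0 ?QN ?b0.
have -> : a * Q ^+ 2 / q = a * (Q ^+ 2 / q) by rewrite -mulrA.
have -> : b * Q * (x / Q) * q = b * x * q by field.
have -> : a * Q ^+ 2 * (x / Q) / (b * (Q / q) * q ^+ 2) = a * x / (b * q).
  by field; rewrite ?q0 ?QN ?b0.
have -> : a * Q ^+ 2 * (x / Q) = a * x * Q by field.
have -> : a * Q ^+ 2 / (b * Q * q ^+ 2) = a * (Q / q ^+ 2) / b.
  by field; rewrite ?q0 ?QN ?b0.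
rewrite mulrA in w2; rewrite [b * (Q * q ^+ 2)]mulrA.
move=> ->; field.
by rewrite ?gN ?gN1 ?w2 ?w3 ?gq ?gb ?ga.
Qed.

Variables (k : int) (free : pred nat).

Definition free_below t : nat := \sum_(j < t | free j) 1.

Lemma free_belowS t : free_below t.+1 = (free_below t + free t)%N.
Proof. by rewrite /free_below big_mkcond big_ord_recr -big_mkcond; case: (free t). Qed.

(** Each free cell lowers the index by one, through [ellfactor_step]. The summand j stands for a
    rook in row j, which leaves the free cells above it uncancelled; the last product stands for an
    empty column. The nonvanishing is carried along since the next step requires it. *)
Lemma ellfactor_column t :
  theta p (a * q ^ (2 * k + 1)) != 0 ->
  (forall j, (j < t)%N -> free j -> weight_den q p a b (k - (free_below j)%:Z) != 0) ->
  theta p (a * q ^ (2 * (k - (free_below t)%:Z) + 1)) != 0 /\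
  ellfactor l p a b z (k - (free_below t)%:Z) =
  \sum_(j < t | free j) \prod_(j' < t | free j' && (j < j')%N)
    weight q p a b (k - (free_below j')%:Z) +
  (\prod_(j < t | free j) weight q p a b (k - (free_below j)%:Z)) *
    ellfactor l p a b z k.
Proof.
move=> gk; elim: t => [|t IH] gw.
  by rewrite /free_below !big_ord0 subr0 mul1r add0r.
have [|g1 E] := IH; first by move=> j jt; apply: gw; rewrite ltnW.
pose w j := weight q p a b (k - (free_below j)%:Z).
have recP (Q : pred nat) : \prod_(j < t.+1 | Q j) w j =
    (\prod_(j < t | Q j) w j) * (if Q t then w t else 1).
  by rewrite big_mkcond big_ord_recr -big_mkcond.
have recS (F : nat -> R[i]) : \sum_(j < t.+1 | free j) F j =
    \sum_(j < t | free j) F j + (if free t then F t else 0).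
  by rewrite big_mkcond big_ord_recr -big_mkcond.
rewrite (recP free) (recS (fun j => \prod_(j' < t.+1 | free j' && (j < j')%N) w j')).
have -> : \prod_(j' < t.+1 | free j' && (t < j')%N) w j' = 1.
  by apply: big1 => j /andP[_]; rewrite ltnNge -ltnS ltn_ord.
rewrite free_belowS; case ft: (free t); last first.
  rewrite addn0 mulr1 addr0; split=> //; rewrite E; congr (_ + _).
  apply: eq_bigr => j _; rewrite (recP (fun j' => free j' && (j < j')%N)) ft.
  by rewrite mulr1.
have wt := gw t (ltnSn t) ft.
rewrite PoszD opprD addrA; split; first exact: weight_den_theta.
rewrite ellfactor_step // E mulrDr addrA; congr (_ + _); last by rewrite /w; ring.
rewrite addrC; congr (_ + _); rewrite mulr_sumr; apply: eq_bigr => j _.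
by rewrite (recP (fun j' => free j' && (j < j')%N)) ft ltn_ord mulrC.
Qed.
End EllipticStep.

(** * Placements column by column *)

(** For a cell in column i and row j: of the c rooks to its left, l are in lower rows and r in
    higher ones, and f of the lower rows are free. *)
Lemma index_arith (i j c l r f : nat) :
  (c <= i)%N -> c = (l + r)%N -> (f + l)%N = j ->
  i%:Z - j%:Z - r%:Z = (i - c)%N%:Z - f%:Z.
Proof. lia. Qed.

Section Columns.
Variables (n : nat) (h : 'I_n -> nat).
Hypotheses (h_mono : forall i j : 'I_n, (i <= j)%N -> (h i <= h j)%N)
  (h_le : forall i : 'I_n, (h i <= n)%N).

Local Notation cell := ('I_n * 'I_n)%type.
Local Notation B := (ferrers n h).

(** Taking the size of P itself as the number of rooks leaves that number unconstrained. *)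
Definition column_placements (i : nat) : {set {set cell}} :=
  [set P : {set cell} | (P \in placements B #|P|) && [forall c in P, (c.1 < i)%N]].

(** For P to the left of column i these are the rows of its uncancelled cells. Rows are natural
    numbers here, to fit [free_below]. *)
Definition free_row (i : 'I_n) (P : {set cell}) (j : nat) : bool :=
  (j < h i)%N && ~~ [exists c in P, c.2 == j :> nat].

Lemma column_placementsP i (P : {set cell}) :
  reflect [/\ forall c, c \in P -> (c.2 < h c.1)%N,
              forall c d, c \in P -> d \in P -> c != d -> (c.1 != d.1) && (c.2 != d.2)
            & forall c, c \in P -> (c.1 < i)%N] (P \in column_placements i).
Proof.
rewrite !inE eqxx /=; apply: (iffP andP) => [[/andP[/fintype.subsetP PB /forall_inP na] /forall_inP lt]|[PB na lt]].
  split=> // [c /PB|c d cP dP]; first by rewrite inE.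
  by move/forall_inP: (na c cP) => /(_ d dP)/implyP.
split; last exact/forall_inP.
apply/andP; split; first by apply/fintype.subsetP => c /PB; rewrite inE.
by apply/forall_inP => c cP; apply/forall_inP => d dP; apply/implyP; apply: na.
Qed.

(** Rooks occupy distinct columns. The bound ensures that i - |P| is a true subtraction. *)
Lemma card_column_placement i (P : {set cell}) :
  (i <= n)%N -> P \in column_placements i -> (#|P| <= i)%N.
Proof.
move=> i_n /column_placementsP[_ na lt].
have inj : {in P &, injective (fun c : cell => c.1)}.
  move=> c d cP dP e; apply/eqP; apply: contraT => ne.
  by have := na c d cP dP ne; rewrite e eqxx.
rewrite -(card_in_imset inj).
have inj_w : injective (widen_ord i_n) by move=> c d /(congr1 val) e; apply: val_inj.
rewrite -[leqRHS](card_ord i) -(card_imset _ inj_w).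
apply: subset_leq_card; apply/fintype.subsetP => _ /imsetP[c cP ->].
apply/imsetP; exists (Ordinal (lt c cP)) => //; exact: val_inj.
Qed.

Section Column.
Variables (i : 'I_n) (P : {set cell}).
Hypothesis Pi : P \in column_placements i.

Let PB c : c \in P -> (c.2 < h c.1)%N. Proof. by case/column_placementsP: Pi => + _ _; apply. Qed.
Let na c d : c \in P -> d \in P -> c != d -> (c.1 != d.1) && (c.2 != d.2).
Proof. by case/column_placementsP: Pi => _ + _; apply. Qed.
Let lt c : c \in P -> (c.1 < i)%N. Proof. by case/column_placementsP: Pi => _ _; apply. Qed.

Lemma notin_column j : (i, j) \notin P.
Proof. by apply/negP => /lt; rewrite ltnn. Qed.

(** Here the Ferrers shape enters: as heights do not decrease, the row of every rook to the left
    meets column i, so that each such rook removes a cell from it. *)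
Lemma rook_lt_h c : c \in P -> (c.2 < h i)%N.
Proof. by move=> cP; rewrite (leq_trans (PB _ cP)) // h_mono // ltnW // lt. Qed.

(** Every row of column i is either free or holds exactly one rook of P. *)
Lemma free_below_rooks t :
  (free_below (free_row i P) t + #|[set c in P | (c.2 < t)%N]| = minn t (h i))%N.
Proof.
elim: t => [|t IH].
  rewrite /free_below big_ord0 min0n; apply/eqP; rewrite cards_eq0.
  by apply/eqP/setP => c; rewrite !inE andbF.
rewrite free_belowS.
have -> : [set c in P | (c.2 < t.+1)%N] = [set c in P | (c.2 < t)%N] :|: [set c in P | c.2 == t :> nat].
  by apply/setP => c; rewrite !inE ltnS leq_eqVlt orbC andb_orr.
have dis : [set c in P | (c.2 < t)%N] :&: [set c in P | c.2 == t :> nat] = finset.set0.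
  by apply/setP => c; rewrite !inE; case: (c \in P) => //=; case: ltngtP.
rewrite cardsU dis cards0 subn0.
have rowt : #|[set c in P | c.2 == t :> nat]| = [exists c in P, c.2 == t :> nat] :> nat.
  case: (boolP [exists c in P, _]) => [/exists_inP[c cP /eqP ct]|ne].
    apply/eqP/cards1P; exists c; apply/setP => d; rewrite !inE.
    apply/andP/eqP => [[dP /eqP dt]|->]; last by rewrite cP ct.
    apply/eqP; apply: contraT => dc; have /andP[_] := na _ _ dP cP dc.
    by rewrite -val_eqE /= dt ct eqxx.
  apply/eqP; rewrite cards_eq0; apply/eqP/setP => c; rewrite !inE.
  apply: contraNF ne => /andP[cP ct]; by apply/exists_inP; exists c.
rewrite rowt [free_row i P t]/free_row; have [th|ht] := ltnP t (h i).
  by move: IH; case: [exists c in P, _] => /=; lia.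
have -> : [exists c in P, c.2 == t :> nat] = false.
  by apply/exists_inP => -[c cP /eqP ct]; have := rook_lt_h _ cP; lia.
by move: IH => /=; lia.
Qed.

(** Hence the index descends from i - |P| to i - h_i along column i. *)
Lemma free_below_total : (free_below (free_row i P) n + #|P| = h i)%N.
Proof.
rewrite -[RHS](minn_idPr (h_le i)) -free_below_rooks; congr (_ + _)%N.
by apply: eq_card => c; rewrite !inE ltn_ord andbT.
Qed.

(** A rook to the left is either above row j, and counted by [nw_rooks], or below it, and then it
    occupies a row that is not free. So the index depends only on |P| and on the rank of the cell
    among the free ones. *)
Lemma cell_index_free (j : 'I_n) : free_row i P j ->
  cell_index P (i, j) =
  ((i - #|P|)%N : int) - (free_below (free_row i P) j)%:Z.
Proof.
move=> /andP[jh nj]; have := free_below_rooks j; rewrite (minn_idPl (ltnW jh)).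
have Pn := card_column_placement _ _ (ltnW (ltn_ord i)) Pi.
have : #|P| = (#|[set c in P | (c.2 < j)%N]| + nw_rooks P (i, j))%N.
  rewrite /nw_rooks -cardsUI /=.
  have -> : [set c in P | (c.2 < j)%N] :&: [set rk in P | (rk.1 < i)%N && (j < rk.2)%N] = finset.set0.
    apply/setP => c; rewrite !inE; case: (c \in P) => //=.
    by case: ltngtP; rewrite ?andbF.
  rewrite cards0 addn0; apply: eq_card => c; rewrite !inE.
  case: (boolP (c \in P)) => //= cP; rewrite lt //=.
  have : c.2 != j :> nat.
    by apply: contraNneq nj => cj; apply/exists_inP; exists c => //; rewrite cj.
  by case: ltngtP.
by move=> e1 e2; rewrite /cell_index; exact: (index_arith _ _ _ _ _ _ Pn e1 e2).
Qed.

Lemma mem_uncancelled_column (j : 'I_n) :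
  ((i, j) \in uncancelled B P) = free_row i P j.
Proof.
rewrite !inE notin_column /free_row /=; congr (_ && ~~ _).
apply/exists_inP/exists_inP => -[c cP].
  case/orP=> [/andP[/eqP cj _]|/andP[/eqP ci _]]; first by exists c => //; rewrite cj.
  by have := lt _ cP; rewrite ci ltnn.
by move=> cj; exists c => //; rewrite /cancels lt // andbT -val_eqE /= cj.
Qed.

Lemma cell_index_add_rook (j : 'I_n) (c : cell) : (c.1 <= i)%N ->
  cell_index ((i, j) |: P) c = cell_index P c.
Proof.
move=> ci; rewrite /cell_index; congr (_ - Posz _); apply: eq_card => rk.
rewrite !inE andb_orl; case: eqP => //= ->.
by rewrite ltnNge ci.
Qed.

Lemma uncancelled_add_rook (j : 'I_n) (c : cell) : (c.1 < i)%N ->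
  (c \in uncancelled B ((i, j) |: P)) = (c \in uncancelled B P).
Proof.
move=> ci; rewrite !inE negb_or.
have -> : c != (i, j) by apply: contraTneq ci => ->; rewrite ltnn.
congr (_ && ~~ _); apply/exists_inP/exists_inP => -[rk]; last first.
  by move=> rkP k; exists rk; rewrite // !inE rkP orbT.
rewrite !inE => /orP[/eqP->|rkP k]; last by exists rk.
rewrite /cancels /= [(i < _)%N]ltnNge (ltnW ci) andbF /=.
by case: eqP ci => // ->; rewrite ltnn.
Qed.

Lemma mem_uncancelled_add_rook (j j' : 'I_n) :
  ((i, j') \in uncancelled B ((i, j) |: P)) = free_row i P j' && (j < j')%N.
Proof.
rewrite -mem_uncancelled_column !inE negb_or.
have -> : [exists rk in (i, j) |: P, cancels rk (i, j')] =
   (j' < j)%N || [exists rk in P, cancels rk (i, j')].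
  apply/exists_inP/orP => [[rk]|[jj|/exists_inP[rk rkP k]]].
  - rewrite !inE => /orP[/eqP->|rkP k]; last by right; apply/exists_inP; exists rk.
    by rewrite /cancels /= ltnn andbF eqxx /=; left.
  - by exists (i, j); rewrite ?inE ?eqxx // /cancels /= eqxx jj orbT.
  - by exists rk; rewrite // !inE rkP orbT.
rewrite negb_or -leqNgt xpair_eqE eqxx /= -val_eqE /=.
by case: (ltngtP j j') => _; rewrite /= ?andbT ?andbF.
Qed.

Lemma column_placementsS : P \in column_placements i.+1.
Proof. by apply/column_placementsP; split => // c cP; rewrite ltnS ltnW // lt. Qed.

Lemma restrict_column_id : [set c in P | (c.1 < i)%N] = P.
Proof.
by apply/setP => c; rewrite !inE; case: (boolP (c \in P)) => //= /lt ->.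
Qed.

Lemma add_rook_column (j : 'I_n) : free_row i P j ->
  (i, j) |: P \in column_placements i.+1 /\
  [set c in (i, j) |: P | (c.1 < i)%N] = P.
Proof.
move=> /andP[jh /exists_inP nj]; split; last first.
  rewrite -[RHS]restrict_column_id; apply/setP => c; rewrite !inE.
  by case: eqP => //= ->; rewrite ltnn andbF.
have nj' c : c \in P -> c.2 != j.
  by move=> cP; apply/eqP => cj; apply: nj; exists c; rewrite // cj.
have ni c : c \in P -> c.1 != i.
  by move=> cP; apply/eqP => ci; have := lt _ cP; rewrite ci ltnn.
apply/column_placementsP; split => [c|c d|c].
- by rewrite !inE => /orP[/eqP->|/PB].
- rewrite !inE => /orP[/eqP->|cP] /orP[/eqP->|dP]; rewrite ?eqxx //= => cd.
  + by rewrite eq_sym ni // eq_sym nj'.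
  + by rewrite ni // nj'.
  + exact: na.
- by rewrite !inE => /orP[/eqP->|/lt/ltnW].
Qed.
End Column.

Lemma restrict_column_placement (i : 'I_n) (P : {set cell}) :
  P \in column_placements i.+1 ->
  [set c in P | (c.1 < i)%N] \in column_placements i.
Proof.
move=> /column_placementsP[PB na lt]; apply/column_placementsP; split => [c|c d|c].
- by rewrite !inE => /andP[/PB].
- by rewrite !inE => /andP[cP _] /andP[dP _]; apply: na.
- by rewrite !inE => /andP[].
Qed.

Lemma column_extension (i : 'I_n) (P Q : {set cell}) :
  P \in column_placements i ->
  (Q \in column_placements i.+1) && ([set c in Q | (c.1 < i)%N] == P) =
  (Q \in P |: [set (i, j) |: P | j : 'I_n & free_row i P j]).
Proof.
move=> Pi; rewrite in_setU1; apply/andP/orP; last first.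
  case=> [/eqP->|/imsetP[j]]; first by rewrite column_placementsS // restrict_column_id.
  by rewrite inE => /(add_rook_column _ _ Pi)[? ?] ->; split=> //; apply/eqP.
move=> [Qi /eqP QP]; have [] := column_placementsP _ _ Qi => QB na lt.
(* A rook of Q outside P lies in column i, and there is at most one of these. *)
have eqi c : c \in Q -> (c \notin P) -> c.1 = i.
  move=> cQ; rewrite -QP inE cQ /= -leqNgt => ic; apply/val_inj/eqP.
  by rewrite eqn_leq ic -ltnS lt.
have PQ c : c \in P -> c \in Q by rewrite -QP inE => /andP[].
have [QsubP|] := boolP (Q \subset P).
  by left; rewrite finset.eqEsubset QsubP; apply/fintype.subsetP.
case/fintype.subsetPn => -[i' j] cQ cP; right.
have ii := eqi _ cQ cP; rewrite /= in ii; subst i'.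
apply/imsetP; exists j.
  rewrite inE /free_row (QB _ cQ) /=; apply/exists_inP => -[d dP /eqP dj].
  have dne : d != (i, j) by apply: contraNneq cP => <-.
  by have /andP[_] := na _ _ (PQ _ dP) cQ dne; rewrite -val_eqE /= dj eqxx.
apply/setP => d; rewrite in_setU1; apply/idP/orP; last first.
  by case=> [/eqP->|/PQ].
move=> dQ; have [dP|dP] := boolP (d \in P); first by right.
left; apply: contraT => dne; have /andP[+ _] := na _ _ dQ cQ dne.
by rewrite (eqi _ dQ dP) eqxx.
Qed.

(** * The product formula for abstract weights that satisfy the column identity *)

Section Sums.
Variables (K : comPzRingType) (w E : int -> K).

(** Columns from t on are left out, since rooks added there later still change which of their cells
    are cancelled. *)
Definition column_weight (t : nat) (P : {set cell}) : K :=
  \prod_(c in uncancelled B P | (c.1 < t)%N) w (cell_index P c).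

Lemma column_weightS (i : 'I_n) P :
  column_weight i.+1 P = column_weight i P *
    \prod_(j < n | (i, j) \in uncancelled B P) w (cell_index P (i, j)).
Proof.
rewrite /column_weight (bigID (fun c : cell => (c.1 < i)%N)) /=; congr (_ * _).
  apply: eq_bigl => c; rewrite -andbA; congr (_ && _).
  by case: (ltnP c.1 i) => ci; rewrite ?andbF // andbT ltnS ltnW.
rewrite (reindex_onto (fun j => (i, j)) (fun c => c.2)) /=.
  by apply: eq_bigl => j; rewrite eqxx andbT ltnSn ltnn !andbT.
move=> [i' j] /= /andP[/andP[_ a] b]; congr pair; apply/val_inj/eqP.
by rewrite eqn_leq; move: a b; rewrite ltnS -leqNgt => -> ->.
Qed.

(** F k will be the product of E(0), ..., E(k-1). Leaving column i empty raises the argument of F by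
    one and yields the factor E(i - |P|); placing a rook leaves the argument unchanged. This matches
    the two parts of the column identity. *)
Lemma column_sum (i : 'I_n) (P : {set cell}) (F : nat -> K) :
  (forall k, F k.+1 = F k * E k) ->
  P \in column_placements i ->
  E (i%:Z - (h i)%:Z) =
    \sum_(j < n | free_row i P j)
      \prod_(j' < n | free_row i P j' && (j < j')%N)
        w ((i - #|P|)%N%:Z - (free_below (free_row i P) j')%:Z) +
    (\prod_(j < n | free_row i P j)
        w ((i - #|P|)%N%:Z - (free_below (free_row i P) j)%:Z)) * E (i - #|P|)%N ->
  \sum_(Q in column_placements i.+1 | [set c in Q | (c.1 < i)%N] == P)
     column_weight i.+1 Q * F (i.+1 - #|Q|)%N =
  E (i%:Z - (h i)%:Z) * (column_weight i P * F (i - #|P|)%N).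
Proof.
move=> FS Pi ->.
rewrite (eq_bigl _ _ (fun Q => column_extension i P Q Pi)).
have inj : {in [set j : 'I_n | free_row i P j] &, injective (fun j => (i, j) |: P)}.
  move=> j1 j2 _ _ e; have : (i, j1) \in (i, j2) |: P by rewrite -e setU11.
  by rewrite in_setU1 (negbTE (notin_column i P Pi j1)) orbF => /eqP[].
rewrite big_setU1 /=; last first.
  apply/imsetP => -[j _ e]; have := notin_column i P Pi j.
  by rewrite e setU11.
rewrite (big_imset _ inj) /= mulrDl addrC; congr (_ + _).
  rewrite big_distrl /=; apply: eq_big => [j|j]; first by rewrite inE.
  rewrite inE => fj; rewrite cardsU1 notin_column // add1n subSS mulrA; congr (_ * _).
  rewrite column_weightS mulrC; congr (_ * _).
    apply: eq_big => [j'|j']; first exact: mem_uncancelled_add_rook.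
    rewrite mem_uncancelled_add_rook // => /andP[fj' _].
    by rewrite cell_index_add_rook // cell_index_free.
  apply: eq_big => [c|c /andP[_ ci]]; last by rewrite cell_index_add_rook // ltnW.
  by case: (ltnP c.1 i) => ci; rewrite ?andbF // uncancelled_add_rook.
rewrite subSn ?(card_column_placement _ _ _ Pi) 1?ltnW // FS column_weightS.
rewrite (eq_bigl _ _ (mem_uncancelled_column i P Pi)).
have -> : \prod_(j < n | free_row i P j) w (cell_index P (i, j)) =
  \prod_(j < n | free_row i P j) w ((i - #|P|)%N%:Z - (free_below (free_row i P) j)%:Z).
  by apply: eq_bigr => j fj; rewrite cell_index_free.
by ring.
Qed.

Hypothesis column_identity : forall (i : 'I_n) (P : {set cell}),
  P \in column_placements i ->
  E (i%:Z - (h i)%:Z) =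
    \sum_(j < n | free_row i P j)
      \prod_(j' < n | free_row i P j' && (j < j')%N)
        w ((i - #|P|)%N%:Z - (free_below (free_row i P) j')%:Z) +
    (\prod_(j < n | free_row i P j)
        w ((i - #|P|)%N%:Z - (free_below (free_row i P) j)%:Z)) * E (i - #|P|)%N.

Lemma column_placements0 : column_placements 0 = finset.set1 finset.set0.
Proof.
apply/setP => P; rewrite finset.in_set1; apply/idP/eqP => [|->].
  by case/column_placementsP=> _ _ lt; apply/setP => c; rewrite inE; apply/negP => /lt.
by apply/column_placementsP; split=> [c|c d|c]; rewrite inE.
Qed.

Lemma prod_columns t : (t <= n)%N ->
  \prod_(i < n | (i < t)%N) E (i%:Z - (h i)%:Z) =
  \sum_(P in column_placements t)
    column_weight t P * \prod_(j < t - #|P|) E j.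
Proof.
elim: t => [_|t IH tn].
  rewrite column_placements0 finset.big_set1 cards0 big_ord0 mulr1.
  rewrite big_pred0 // /column_weight big_pred0 // => c.
  by rewrite andbF.
pose i := Ordinal tn.
rewrite (bigD1 i) //= (eq_bigl (fun j : 'I_n => (j < t)%N)); last first.
  move=> j; rewrite ltnS leq_eqVlt -val_eqE /=.
  by case: ltngtP.
rewrite IH ?(ltnW tn) // big_distrr /=.
(* Placements in the first t + 1 columns are grouped by their restriction to the first t. *)
rewrite [RHS](partition_big (fun Q : {set cell} => [set c in Q | (c.1 < i)%N])
  (mem (column_placements i))) /=; last by move=> Q; exact: (restrict_column_placement i).
apply: eq_bigr => P Pi; symmetry.
apply: (@column_sum i P (fun k => \prod_(j < k) E j)) => //.
  by move=> k; rewrite big_ord_recr.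
exact: column_identity.
Qed.

Lemma placements_column k : (k <= n)%N ->
  placements B (n - k) = [set P in column_placements n | (n - #|P|)%N == k].
Proof.
move=> kn; apply/setP => P; apply/idP/finset.setIdP => [Pk|[Pn /eqP Pk]].
  have cP : #|P| = (n - k)%N by move: Pk; rewrite inE => /and3P[_ /eqP].
  split; last by rewrite cP subKn.
  by rewrite inE cP Pk /=; apply/forall_inP => c _.
have Pc := card_column_placement n P (leqnn n) Pn.
by move: Pn; rewrite inE -Pk subKn // => /andP[].
Qed.

Lemma prod_columns_rook :
  \prod_(i < n) E (i%:Z - (h i)%:Z) =
  \sum_(k < n.+1)
    (\sum_(P in placements B (n - k))
       \prod_(c in uncancelled B P) w (cell_index P c)) * \prod_(j < k) E j.
Proof.
have := prod_columns n (leqnn n).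
rewrite (eq_bigl xpredT) => [->|i]; last by rewrite ltn_ord.
(* Placements are sorted by k = n - |P|; as this is at most n, [inord] does not alter it. *)
rewrite (partition_big (fun P : {set cell} => inord (n - #|P|) : 'I_n.+1) xpredT) //=.
apply: eq_bigr => k _; have kn : (k <= n)%N by rewrite -ltnS ltn_ord.
rewrite placements_column //.
rewrite big_distrl /=.
apply: eq_big => P.
  by apply/andP/finset.setIdP => -[Pn e]; split=> //; move: e;
    rewrite -val_eqE /= inordK // ltnS leq_subr.
move=> /andP[_ /eqP <-].
rewrite inordK ?ltnS ?leq_subr //.
congr (_ * _).
by apply: eq_bigl => c; rewrite ltn_ord andbT.
Qed.

End Sums.
End Columns.

(* h i is b_{i+1}: columns and factors are indexed from 0.
   l is a value of log q, used to define q^z.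
   "Generic" means a, b != 0 (q != 0 follows from q = expC l) and that none of
   the denominators occurring in the identity vanishes. *)
Theorem theorem4p3 (R : realType) (p q l a b z : R[i])
  (n : nat) (h : 'I_n -> nat)
  (hp : `|p| < 1) (hq : expC l = q) (ha : a != 0) (hb : b != 0)
  (h_mono : forall i j : 'I_n, (i <= j)%N -> (h i <= h j)%N)
  (h_le : forall i : 'I_n, (h i <= n)%N)
  (gen_lhs : forall i : 'I_n,
     ellnum_den l p (a * q ^ (2 * (i%:Z - (h i)%:Z)))
       (b * q ^ (i%:Z - (h i)%:Z)) (z + (h i)%:R - i%:R) != 0)
  (gen_rhs : forall j : 'I_n,
     ellnum_den l p (a * q ^+ (2 * j)) (b * q ^+ j) (z - j%:R) != 0)
  (gen_weight : forall (k : nat) (P : {set 'I_n * 'I_n}) (c : 'I_n * 'I_n),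
     P \in placements (ferrers n h) k -> c \in uncancelled (ferrers n h) P ->
     weight_den q p a b (cell_index P c) != 0) :
  \prod_(i < n)
     ellnum l p (a * q ^ (2 * (i%:Z - (h i)%:Z)))
       (b * q ^ (i%:Z - (h i)%:Z)) (z + (h i)%:R - i%:R)
  = \sum_(k < n.+1)
      rook_number q p a b (ferrers n h) (n - k) *
      \prod_(j < k)
        ellnum l p (a * q ^+ (2 * j)) (b * q ^+ j) (z - j%:R).
Proof.
subst q.
have den k : ellnum_den l p (a * expC l ^+ (2 * k)) (b * expC l ^+ k) (z - k%:R) =
  theta p (expC l) * theta p (a * expC l ^ (2 * k%:Z + 1)) *
  theta p (b * qpow l z * expC l) * theta p (a * qpow l z / (b * expC l)).
  by rewrite -ellfactor_denE // -!exprnP.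
have gen (k : nat) : (k < n)%N -> [/\ theta p (expC l) != 0,
    theta p (a * expC l ^ (2 * k%:Z + 1)) != 0,
    theta p (b * qpow l z * expC l) != 0 & theta p (a * qpow l z / (b * expC l)) != 0].
  move=> kn; have := gen_rhs (Ordinal kn); rewrite /= den !mulf_eq0 !negb_or.
  by move=> /andP[/andP[/andP[]]].
rewrite (eq_bigr (fun i : 'I_n => ellfactor l p a b z (i%:Z - (h i)%:Z))); last first.
  move=> i _; rewrite /ellfactor; congr (ellnum _ _ _ _ _).
  by rewrite intrD rmorphN /= opprD opprK addrA addrAC.
rewrite (@prod_columns_rook n h h_mono _ (weight (expC l) p a b)
  (ellfactor l p a b z)).
  by apply: eq_bigr => k _; congr (_ * _); apply: eq_bigr.
move=> i P Pi.
have Pn : (#|P| <= i)%N by rewrite (card_column_placement _ _ _ _ _ Pi) // ltnW.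
(* The recursion in column i starts from E(i - |P|), whose index also occurs in the products on the
   right of the theorem; [gen_rhs] therefore makes its denominator nonzero. *)
have kn : (i - #|P| < n)%N by rewrite (leq_ltn_trans (leq_subr _ _)).
have [gq gk gb ga] := gen _ kn.
have Pp : P \in placements (ferrers n h) #|P| by move: Pi; rewrite inE => /andP[].
have [|_] := ellfactor_column _ l p a b z hp ha hb gq gb ga _ (free_row _ h i P) n gk.
  move=> j jn fj; have := gen_weight _ P (i, Ordinal jn) Pp.
  by rewrite (mem_uncancelled_column _ h i P Pi) => /(_ fj); rewrite (cell_index_free _ h h_mono i P Pi (Ordinal jn) fj).
have <- : i%:Z - (h i)%:Z = (i - #|P|)%N%:Z - (free_below (free_row _ h i P) n)%:Z.
  have := free_below_total _ h h_mono h_le i P Pi.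
  by move: (free_below _ _) #|P| (h i) Pn => f c hi; lia.
by [].
Qed.
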